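(* Let $n,m\in\mathbb{N}_0$ and let $T:V(n)\to V(m)$ be a $\mathbb{C}$-linear operator which restricts to a real linear operator from $V_{\mathbb{R}}(n)$ to $V_{\mathbb{R}}(m)$. Let $I\subseteq\mathbb{R}$ be any interval, and let $J\subset\mathbb{R}$ be any closed bounded interval. The following are equivalent. (i) $T$ preserves weak real-rootedness and maps $I$-rooted polynomials to nonzero $J$-rooted polynomials. (ii) One of the following holds: (a) $\operatorname{Symb}(T)$ is $(\mathcal{H}_-\cup I)\times(\overline{\mathcal{H}_+}\setminus J)$-stable. (b) $\operatorname{Symb}(T)$ is $(\mathcal{H}_-\cup I)\times(\overline{\mathcal{H}_-}\setminus J)$-stable. (c) $T$ has image of dimension at most two and is of the form $T:p\mapsto q\cdot\psi_1(p)+r\cdot\psi_2(p)$, where $q,r\in V_{\mathbb{R}}(m)$ are top-degree monic and weakly $J$-rooted such that $q\ll r$, and $\psi_1$ and $\psi_2$ are real linear functionals such that $\psi_1(p)\cdot\psi_2(p)\ge0$ (not both zero) holds for any $I$-rooted $p$.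
   Context: For $n\in\mathbb{N}_0$, $V(n)$ (resp. $V_{\mathbb{R}}(n)$) is the space of homogeneous polynomials of degree $n$ in $x,y$ with complex (resp. real) coefficients; for $(n,m)\in\mathbb{N}_0^2$, $V(n,m)$ is the space of complex polynomials in two pairs of variables, homogeneous of degree $n$ in the first pair and $m$ in the second. $\mathbb{CP}^1\ni(a:b)$ is identified with $\mathbb{C}\cup\{\infty\}$ via $a/b$. A nonzero $p\in V(n)$ has exactly $n$ roots in $\mathbb{CP}^1$ with multiplicity. For a set $\Omega$ in $\mathbb{CP}^1$ (or $(\mathbb{CP}^1)^2$), a polynomial is $\Omega$-stable if it does not vanish in $\Omega$, and weakly $\Omega$-stable if it is $\Omega$-stable or identically zero. $\mathcal{H}_\pm$ are the open upper/lower half-planes; closures $\overline{\mathcal{H}_\pm}$ are in $\mathbb{CP}^1$ (they contain $\mathbb{R}\cup\{\infty\}$). For $J\subseteq\mathbb{R}\cup\{\infty\}$, a polynomial is $J$-rooted if all its roots in $\mathbb{CP}^1$ lie in $J$; weakly $J$-rooted allows also the zero polynomial. Real-rooted means all roots lie in $\mathbb{R}\cup\{\infty\}$; $T$ preserves weak real-rootedness if $T(p)$ is real-rooted or zero for every real-rooted $p\in V_{\mathbb{R}}(n)$. $p\in V(m)$ is top-degree monic if its coefficient of $x^m$ is $1$. For $p,q\in V_{\mathbb{R}}(m)$, $p\ll q$ means that $q+ip$ is weakly $\mathcal{H}_+$-stable. A real linear functional is a linear functional $V_{\mathbb{R}}(n)\to\mathbb{R}$ (so the sign condition in (c) is about $p\in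 V_{\mathbb{R}}(n)$), extended $\mathbb{C}$-linearly to $V(n)$ in the formula for $T$. Symbol: $\operatorname{Symb}(T):=T[(zy-xw)^n]=\sum_{k=0}^n\binom{n}{k}z^{n-k}(-w)^kT(x^ky^{n-k})\in V(n,m)$, where $T$ acts only on $x,y$; the pairs of variables are ordered as $(z,w),(x,y)$.
   Formalization: The interval I is required to contain at least two points; for I empty or a single point the equivalence fails, e.g. n=m=2, I={0}, J=[-1,1], T(x^2)=x^2-y^2, T(xy)=0, T(y^2)=xy satisfies (i) but none of (a), (b), (c). *)

(* Defs.v *)
From HB Require Import structures.
From mathcomp Require Import all_boot all_order all_algebra.
From mathcomp Require Import classical_sets set_interval reals.
From mathcomp Require Import complex mpoly.

Set Implicit Arguments.
Unset Strict Implicit.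
Unset Printing Implicit Defensive.

Import Order.TTheory GRing.Theory Num.Theory.
Local Open Scope ring_scope.
Local Open Scope complex_scope.
Local Open Scope classical_set_scope.

(* Homogeneous polynomials of degree n over K in x = 'X_0 and y = 'X_1 (the
   zero polynomial included): V R[i] n and V R n are V(n) and V_R(n). *)
Notation V K n := (dhomog 2 K n).

Lemma homog_map_mpoly (k d : nat) (K L : nzRingType) (f : {additive K -> L})
  (p : dhomog k K d) : map_mpoly f p \is d.-homog.
Proof.
apply/dhomogP => m; rewrite mcoeff_msupp mcoeff_map_mpoly => nz.
apply: (dhomog_mf (dhomog_is_dhomog p)); rewrite mcoeff_msupp.
by apply: contraNneq nz => ->; rewrite raddf0.
Qed.

Definition homog_map (k d : nat) (K L : nzRingType) (f : {additive K -> L})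
  (p : dhomog k K d) : dhomog k L d := DHomog (homog_map_mpoly f p).

Lemma homog_monomial (K : nzRingType) (n : nat) (k : 'I_n.+1) :
  ('X_ord0 ^+ k * 'X_ord_max ^+ (n - k) : {mpoly K[2]}) \is n.-homog.
Proof.
rewrite -[X in X.-homog](subnKC (leq_ord k)).
by apply: dhomogM; rewrite mpolyXn dhomogX /= mdegMn mdeg1 mul1n.
Qed.

(* x^k y^(n-k) *)
Definition monomial (K : nzRingType) (n : nat) (k : 'I_n.+1) : V K n :=
  DHomog (homog_monomial K k).

Section Complexification.
Variable R : realType.

Definition cplx n (p : V R n) : V R[i] n := homog_map (real_complex R) p.

Definition polyRe n (p : V R[i] n) : V R n := homog_map (@complex.Re R) p.

Definition polyIm n (p : V R[i] n) : V R n := homog_map (@complex.Im R) p.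

(* the C-linear extension to V(n) of a functional on V_R(n) *)
Definition cextend n (psi : {scalar V R n}) (p : V R[i] n) : R[i] :=
  (psi (polyRe p))%:C + 'i * (psi (polyIm p))%:C.

End Complexification.

(* CP^1 = C u {oo}: Some t stands for (t : 1) and None for (1 : 0). *)
Notation CP1 R := (option R[i]).

Section Stability.
Variable R : realType.
Implicit Types (A : set R) (P : CP1 R).

(* Vanishing of a homogeneous polynomial at a point of CP^1 does not depend on
   the representative. *)
Definition coords P : 'I_2 -> R[i] :=
  if P is Some t then tnth [tuple t; 1] else tnth [tuple 1; 0].

Definition upper_half : set (CP1 R) := [set Some t | t in [set t | 0 < complex.Im t]].

Definition lower_half : set (CP1 R) := [set Some t | t in [set t | complex.Im t < 0]].

Definition real_points A : set (CP1 R) := [set Some x%:C | x in A].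

Definition extended_reals : set (CP1 R) := real_points setT `|` [set None].

Definition closed_upper_half := upper_half `|` extended_reals.

Definition closed_lower_half := lower_half `|` extended_reals.

Definition stable (Omega : set (CP1 R)) n (p : V R[i] n) :=
  forall P, Omega P -> p.@[coords P] != 0.

Definition weakly_stable (Omega : set (CP1 R)) n (p : V R[i] n) :=
  stable Omega p \/ p = 0.

(* V(n, m) is realised in four variables z, w, x, y, in this order. *)
Definition coords2 (PQ : CP1 R * CP1 R) (i : 'I_(2 + 2)) : R[i] :=
  match split i with inl j => coords PQ.1 j | inr j => coords PQ.2 j end.

Definition stable2 (Omega : set (CP1 R * CP1 R)) (s : {mpoly R[i][2 + 2]}) :=
  forall PQ, Omega PQ -> s.@[coords2 PQ] != 0.

(* The zero polynomial vanishes everywhere, so it is J-rooted for no J other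
   than CP^1. *)
Definition rooted (J : set (CP1 R)) n (p : V R[i] n) :=
  forall P, p.@[coords P] = 0 -> J P.

Definition weakly_rooted (J : set (CP1 R)) n (p : V R[i] n) :=
  rooted J p \/ p = 0.

Definition top_monic n (p : V R n) := (p : {mpoly R[2]})@_(U_(ord0) *+ n) = 1.

(* p << q *)
Definition interlaces n (p q : V R n) :=
  weakly_stable upper_half (cplx q + 'i *: cplx p).

Definition real_operator n m (T : 'Hom(V R[i] n, V R[i] m)) :=
  forall p : V R n, exists q : V R m, T (cplx p) = cplx q.

Definition preserves_weak_real_rootedness n m (T : 'Hom(V R[i] n, V R[i] m)) :=
  forall p : V R n,
    rooted extended_reals (cplx p) -> weakly_rooted extended_reals (T (cplx p)).

(* z and w are the variables 'X_0 and 'X_1; second_pair renames the variables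
   of V(m) to 'X_2 and 'X_3. *)
Definition second_pair m (p : V R[i] m) : {mpoly R[i][2 + 2]} :=
  p \mPo [tuple 'X_(rshift 2 i) | i < 2].

Definition Symb n m (T : 'Hom(V R[i] n, V R[i] m)) : {mpoly R[i][2 + 2]} :=
  \sum_(k < n.+1)
    'C(n, k)%:R *: ('X_(lshift 2 ord0) ^+ (n - k) *
                    (- 'X_(lshift 2 ord_max)) ^+ k *
                    second_pair (T (monomial R[i] k))).

End Stability.

Arguments upper_half {R}.
Arguments lower_half {R}.
Arguments extended_reals {R}.
Arguments closed_upper_half {R}.
Arguments closed_lower_half {R}.

(* Main.v *)
(* Write F_z for T applied to the n-th power of the linear form with root z: up
   to sign, F_z is Symb(T) at z. Identify V(n) with univariate polynomials of
   degree at most n.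

   From (a) or (b): the Grace-Walsh-Szego theorem holds for the union of the
   open lower half-plane and I, because one Laguerre step only needs the
   complement of this set to become convex under h |-> 1/h. It carries the
   nonvanishing of F_z over to T(p) for all p with roots in the set; real roots
   outside I are reached in the limit (Hurwitz). From (c): Hermite-Biehler.

   Conversely, compare |F_z(x)| with |F_(conj z)(x)| for z in the lower and x in
   the upper half-plane. If they never agree, the same one is always the larger
   one by connectedness, so F_z(x), resp. F_z(conj x), never vanishes, and the
   boundary points outside J follow by Hurwitz. If they agree once, a
   combination of (X-z)^n and its conjugate with n simple real roots lies in the
   kernel of T; adding to it a small multiple of an arbitrary real f shows that
   T(f) is real-rooted or 0. A space of such polynomials has dimension at most
   2, and (c) is obtained by taking for q and r the two ends of the segment of
   monic J-rooted polynomials in this space. *)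
From HB Require Import structures.
Require Import Defs.
From mathcomp Require Import all_boot all_order all_algebra.
From mathcomp Require Import boolp classical_sets set_interval reals.
From mathcomp Require Import complex mpoly ring lra.

Set Implicit Arguments.
Unset Strict Implicit.
Unset Printing Implicit Defensive.

Import Order.TTheory GRing.Theory Num.Theory.
Local Open Scope ring_scope.
Local Open Scope complex_scope.
Local Open Scope classical_set_scope.

(** * Homogeneous bivariate polynomials as univariate polynomials *)

(** No topology is used: limits and connectedness arguments run along polynomial families in one
    real parameter, where the intermediate value theorem for real polynomials and explicit estimates
    on coefficients do the work.

    Equality of the two moduli means v F_z(x) = conj(v) F_(conj z)(x) for some unit v. With P = v
    (X-z)^n, the operator therefore maps i(P - conj P) to a polynomial that vanishes at the nonreal
    point x. Hermite-Biehler makes i(P - conj P) real-rooted, so its image is real-rooted or 0,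
    hence 0. All roots of P lie in an open half-plane, and this survives a small perturbation of P
    by any polynomial of degree at most n: this is how a real f that need not be real-rooted gets
    under control.

    The danger in each use of Hurwitz is a limit that vanishes identically. At the boundary of the
    half-planes it is excluded by a point t of I, since (X-t)^n has a J-rooted image. *)

Section Dehomogenization.
Variable K : comNzRingType.

Definition bidegree (k l : nat) : 'X_{1..2} :=
  (U_(ord0) *+ k + U_(ord_max) *+ l)%MM.

Definition dehom n (p : V K n) : {poly K} :=
  \poly_(k < n.+1) (p : {mpoly K[2]})@_(bidegree k (n - k)).

Definition hom n (f : {poly K}) : V K n := \sum_(k < n.+1) f`_k *: monomial K k.

Definition heval n (f : {poly K}) (x y : K) : K :=
  \sum_(k < n.+1) f`_k * (x ^+ k * y ^+ (n - k)).

Lemma size_dehom n (p : V K n) : (size (dehom p) <= n.+1)%N.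
Proof. exact: size_poly. Qed.

Lemma dehom_is_linear n : linear (@dehom n).
Proof.
move=> c p q; apply/polyP => k.
rewrite coefD coefZ !coef_poly; case: ifP => _; last by rewrite mulr0 addr0.
by rewrite mcoeffD mcoeffZ.
Qed.
HB.instance Definition _ n :=
  GRing.isLinear.Build K (V K n) {poly K} _ (@dehom n) (@dehom_is_linear n).

Lemma hom_is_linear n : linear (@hom n).
Proof.
move=> c f g; rewrite /hom scaler_sumr -big_split; apply: eq_bigr => k _ /=.
by rewrite coefD coefZ scalerDl scalerA.
Qed.
HB.instance Definition _ n :=
  GRing.isLinear.Build K {poly K} (V K n) _ (@hom n) (@hom_is_linear n).

Lemma mcoeff_monomial n (k : 'I_n.+1) (m : 'X_{1..2}) :
  (monomial K k : {mpoly K[2]})@_m = (bidegree k (n - k) == m)%:R.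
Proof. by rewrite /= !mpolyXn -mpolyXD mcoeffX. Qed.

Lemma bidegree0 k l : bidegree k l ord0 = k.
Proof. by rewrite mnmDE !mulmnE !mnm1E /= mul1n mul0n addn0. Qed.

Lemma bidegree_eta (m : 'X_{1..2}) : m = bidegree (m ord0) (mdeg m - m ord0).
Proof.
apply/mnmP => i; rewrite mnmDE !mulmnE !mnm1E mdegE !big_ord_recl big_ord0.
have [->|->] : i = ord0 \/ i = ord_max.
  by case: i => [[|[|//]] ?]; [left|right]; apply/val_inj.
  by rewrite /= mul1n mul0n addn0.
rewrite /= mul0n mul1n add0n addn0 addKn; congr (m _); exact/val_inj.
Qed.

Lemma mcoeff_hom n f (k : 'I_n.+1) :
  (hom n f : {mpoly K[2]})@_(bidegree k (n - k)) = f`_k.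
Proof.
rewrite /hom raddf_sum /= raddf_sum (bigD1 k) //= mcoeffZ mcoeff_monomial eqxx mulr1.
rewrite big1 ?addr0 // => j; rewrite mcoeffZ mcoeff_monomial.
move=> nj; case: (bidegree j _ =P _) => [E|_]; last by rewrite mulr0.
by have := bidegree0 j (n - j); rewrite E bidegree0 => /val_inj kj; rewrite kj eqxx in nj.
Qed.

Lemma homK n (f : {poly K}) : (size f <= n.+1)%N -> dehom (hom n f) = f.
Proof.
move=> sf; apply/polyP => k; rewrite coef_poly; case: ltnP => [lt_k|ge_k].
  exact: (@mcoeff_hom n f (Ordinal lt_k)).
by rewrite nth_default // (leq_trans sf).
Qed.

Lemma dehomK n : cancel (@dehom n) (@hom n).
Proof.
move=> p; apply/val_inj/mpolyP => m /=.
have [md|md] := eqVneq (mdeg m) n; last first.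
  by rewrite !(@dhomog_nemf_coeff _ _ mdeg n) ?dhomog_is_dhomog.
have lt_m : (m ord0 < n.+1)%N.
  by rewrite ltnS -md mdegE big_ord_recl leq_addr.
rewrite [m]bidegree_eta md (@mcoeff_hom n (dehom p) (Ordinal lt_m)).
by rewrite coef_poly /= lt_m.
Qed.

Lemma meval_dehom n (p : V K n) (v : 'I_2 -> K) :
  (p : {mpoly K[2]}).@[v] = heval n (dehom p) (v ord0) (v ord_max).
Proof.
rewrite -[in LHS](dehomK p) /hom raddf_sum /= raddf_sum; apply: eq_bigr => k _ /=.
by rewrite mevalZ mevalM !rmorphXn /= !mevalXU.
Qed.

End Dehomogenization.

Lemma dehom_map (K L : comNzRingType) (f : {additive K -> L}) n (p : V K n) :
  dehom (homog_map f p) = map_poly f (dehom p).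
Proof.
apply/polyP => k; rewrite coef_map_id0 ?raddf0 // !coef_poly.
by case: ifP => _; rewrite ?raddf0 //= mcoeff_map_mpoly.
Qed.

Local Notation Re := (@complex.Re _).
Local Notation Im := (@complex.Im _).

(** * Polynomials with zeros in a half-plane *)

Section ComplexPoly.
Variable R : rcfType.
Notation C := R[i].
Implicit Types (x y z : C) (p q P Q : {poly C}).

(** The squared modulus with values in [R]: the order is total there, and along a polynomial path
    [nsq] is a real polynomial in the parameter. *)
Definition nsq z : R := Re z ^+ 2 + Im z ^+ 2.

Lemma nsqM x y : nsq (x * y) = nsq x * nsq y.
Proof. by case: x y => [a b] [c d]; rewrite /nsq /=; ring. Qed.

Lemma nsqJ x : nsq (conjc x) = nsq x.
Proof. by case: x => [a b]; rewrite /nsq /= sqrrN. Qed.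

Lemma nsq_ge0 x : 0 <= nsq x.
Proof. by rewrite addr_ge0 ?sqr_ge0. Qed.

Lemma nsq_eq0 x : (nsq x == 0) = (x == 0).
Proof.
by case: x => [a b]; rewrite /nsq paddr_eq0 ?sqr_ge0 //= !sqrf_eq0 eq_complex.
Qed.

Lemma nsq_gt0 x : (0 < nsq x) = (x != 0).
Proof. by rewrite lt_def nsq_ge0 nsq_eq0 andbT. Qed.

Lemma nsq1 : nsq 1 = 1.
Proof. by rewrite /nsq /= expr1n expr0n addr0. Qed.

Lemma nsqV x : nsq x^-1 = (nsq x)^-1.
Proof.
have [->|x0] := eqVneq x 0; first by rewrite invr0 /nsq /= expr0n addr0 invr0.
by apply: (mulfI (_ : nsq x != 0)); rewrite ?nsq_eq0 // -nsqM !divff ?nsq1 ?nsq_eq0.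
Qed.

Lemma Re_addc x y : Re (x + y) = Re x + Re y. Proof. by case: x y => [? ?] []. Qed.
Lemma Im_addc x y : Im (x + y) = Im x + Im y. Proof. by case: x y => [? ?] []. Qed.
Lemma Re_oppc x : Re (- x) = - Re x. Proof. by case: x. Qed.
Lemma Im_oppc x : Im (- x) = - Im x. Proof. by case: x. Qed.
Lemma Re_mulc x y : Re (x * y) = Re x * Re y - Im x * Im y.
Proof. by case: x y => [? ?] []. Qed.
Lemma Im_mulc x y : Im (x * y) = Re x * Im y + Im x * Re y.
Proof. by case: x y => [? ?] []. Qed.
Lemma Re_conjc x : Re (conjc x) = Re x. Proof. by case: x. Qed.
Lemma Im_conjc x : Im (conjc x) = - Im x. Proof. by case: x. Qed.
Lemma Re_invc x : Re x^-1 = Re x / nsq x. Proof. by case: x. Qed.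
Lemma Im_invc x : Im x^-1 = - Im x / nsq x. Proof. by case: x => a b; rewrite mulNr. Qed.

Definition cE := (Re_addc, Im_addc, Re_oppc, Im_oppc, Re_mulc, Im_mulc, Re_conjc, Im_conjc).

Lemma complex_eq x y : Re x = Re y -> Im x = Im y -> x = y.
Proof. by case: x y => [a b] [c d] /= -> ->. Qed.

Lemma conjc_id x : ((conjc x) = x) <-> (Im x = 0).
Proof.
split; first by case: x => a b [] /eqP; rewrite eq_sym -addr_eq0 -mulr2n mulrn_eq0 /= => /eqP.
by case: x => a b /= ->; rewrite oppr0.
Qed.

Definition conjp p := map_poly conjc p.

Lemma horner_conjp p x : (conjp p).[x] = (p.[conjc x])^*.
Proof. by rewrite -[x in LHS]conjcK horner_map. Qed.

Lemma nsq_conjp p x : nsq (conjp p).[x] = nsq p.[conjc x].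
Proof. by rewrite horner_conjp nsqJ. Qed.

(** The difference of the two sides is -4 Im x Im r. Multiplied over all roots, this is the
    Hermite-Biehler inequality. *)
Lemma nsq_factor_le x r : Im r <= 0 -> 0 < Im x -> nsq ((conjc x) - r) <= nsq (x - r).
Proof. by rewrite /nsq !cE; nra. Qed.

Lemma nsq_factor_lt x r : Im r < 0 -> 0 < Im x -> nsq ((conjc x) - r) < nsq (x - r).
Proof. by rewrite /nsq !cE; nra. Qed.

Lemma nsq_lower_le P x : (forall r, root P r -> Im r <= 0) -> 0 < Im x ->
  nsq P.[conjc x] <= nsq P.[x].
Proof.
have [s ->] := closed_field_poly_normal P; move=> hP x0.
have [->|lc0] := eqVneq (lead_coef P) 0; first by rewrite scale0r !horner0.
rewrite !hornerZ !nsqM ler_wpM2l ?nsq_ge0 //.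
have {hP} : {in s, forall r, Im r <= 0}.
  by move=> r rs; apply: hP; rewrite rootZ // root_prod_XsubC.
elim: s => [|r s IHs] hs; first by rewrite !big_nil !hornerE.
rewrite !big_cons !hornerM !nsqM !hornerXsubC ler_pM ?nsq_ge0 //.
  by rewrite nsq_factor_le ?hs ?mem_head.
by apply: IHs => t ts; apply: hs; rewrite in_cons ts orbT.
Qed.

(** The factor of a single nonreal root is strict, and the cofactor is nonzero at [x] because [P]
    has no root in the upper half-plane. *)
Lemma nsq_lower_lt P x r : P != 0 -> (forall r, root P r -> Im r <= 0) ->
  root P r -> Im r < 0 -> 0 < Im x -> nsq P.[conjc x] < nsq P.[x].
Proof.
move=> P0 hP /factor_theorem[Q PQ] r0 x0; rewrite PQ in P0 hP *.
rewrite !hornerM !nsqM !hornerXsubC; apply: (@le_lt_trans _ _ (nsq Q.[x] * nsq ((conjc x) - r))).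
  rewrite ler_wpM2r ?nsq_ge0 // nsq_lower_le // => t Qt.
  by apply: hP; rewrite rootM Qt.
rewrite ltr_pM2l ?nsq_factor_lt // nsq_gt0; apply/negP => Qx.
have : Im x <= 0 by apply: hP; rewrite rootM /root Qx.
by rewrite leNgt x0.
Qed.

Lemma nsq_lower_lt_size P x : (1 < size P)%N -> (forall r, root P r -> Im r < 0) ->
  0 < Im x -> nsq P.[conjc x] < nsq P.[x].
Proof.
move=> sP hP; have /closed_rootP[r Pr] : size P != 1 by rewrite neq_ltn sP orbT.
apply: nsq_lower_lt Pr (hP _ Pr) => [|t /hP/ltW//].
by rewrite -size_poly_gt0 ltnW.
Qed.

Lemma Re_horner p (t : R) : Re p.[t%:C] = (map_poly Re p).[t].
Proof.
rewrite (@horner_coef_wide _ (size p) (map_poly Re p)) ?size_poly // horner_coef.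
have RS : {morph @complex.Re R : x y / x + y >-> x + y} by move=> x y; rewrite Re_addc.
have R0 : Re (0 : C) = 0 by []; rewrite (big_morph _ RS R0); apply: eq_bigr => i _.
by rewrite coef_map_id0 // -rmorphXn Re_mulc /= mulr0 subr0.
Qed.

Lemma Im_horner p (t : R) : Im p.[t%:C] = (map_poly Im p).[t].
Proof.
rewrite (@horner_coef_wide _ (size p) (map_poly Im p)) ?size_poly // horner_coef.
have RS : {morph @complex.Im R : x y / x + y >-> x + y} by move=> x y; rewrite Im_addc.
have R0 : Im (0 : C) = 0 by []; rewrite (big_morph _ RS R0); apply: eq_bigr => i _.
by rewrite coef_map_id0 // -rmorphXn Im_mulc /= mulr0 add0r.
Qed.

Lemma nsq_ivt P Q : (forall t : R, 0 <= t <= 1 -> nsq P.[t%:C] != nsq Q.[t%:C]) ->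
  nsq Q.[0] < nsq P.[0] -> nsq Q.[1] < nsq P.[1].
Proof.
move=> hPQ h0; rewrite ltNge; apply/negP => h1.
pose D := map_poly Re Q ^+ 2 + map_poly Im Q ^+ 2 -
          (map_poly Re P ^+ 2 + map_poly Im P ^+ 2) : {poly R}.
have DE t : D.[t] = nsq Q.[t%:C] - nsq P.[t%:C].
  by rewrite !hornerE -!Re_horner -!Im_horner.
have [] := @poly_ivt _ D 0 1 ler01.
  by rewrite !DE subr_ge0 subr_le0 ltW.
move=> t t01; rewrite /root DE subr_eq0 eq_sym => /eqP E.
by have := hPQ t; rewrite E eqxx => /(_ t01).
Qed.

End ComplexPoly.

(** * Hurwitz' theorem *)

Section Hurwitz.
Variable R : rcfType.
Notation C := R[i].
Implicit Types (x y z : C) (p q P Q : {poly C}).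

Lemma normc_ge_Im (d : R) z : 0 <= d -> d <= Im z -> d%:C <= `|z|.
Proof.
move=> d0 dz; rewrite -(@ler_pXn2r _ 2) ?nnegrE ?normr_ge0 ?ler0c //.
rewrite -add_Re2_Im2 -rmorphXn lecR.
by apply: (@le_trans _ _ (Im z ^+ 2)); [rewrite ler_pXn2r ?nnegrE ?(le_trans d0)|nra].
Qed.

Lemma normc_geN_Im (d : R) z : 0 <= d -> d <= - Im z -> d%:C <= `|z|.
Proof. by move=> d0 dz; rewrite -normrN normc_ge_Im // Im_oppc. Qed.

(** Normalised to constant term 1, [Q] is a product of factors 1 - X/r, and the coefficients of each
    have moduli of sum at most 1 + 1/d. Only the degree of [Q] enters, so the bound is uniform along
    a family. *)
Lemma coefs_le_coef0 Q (d : C) k : 0 < d -> (forall r, root Q r -> d <= `|r|) ->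
  `|Q`_k| <= (1 + d^-1) ^+ (size Q).-1 * `|Q`_0|.
Proof.
have [s ->] := closed_field_poly_normal Q; move=> d0 hQ.
have [->|lc0] := eqVneq (lead_coef Q) 0.
  by rewrite scale0r !coef0 normr0 mulr0.
rewrite size_scale // size_prod_XsubC /= !coefZ !normrM mulrCA ler_wpM2l //.
have {hQ} : {in s, forall r, d <= `|r|}.
  by move=> r rs; apply: hQ; rewrite rootZ // root_prod_XsubC.
elim: s k => [|r s IHs] k hs; first by rewrite big_nil /= expr0 mul1r !coef1 normr1; case: k => [|k]; rewrite ?normr1 ?normr0 ?ler01.
have {}IHs j : `|(\prod_(r0 <- s) ('X - r0%:P))`_j| <=
    (1 + d^-1) ^+ size s * `|(\prod_(r0 <- s) ('X - r0%:P))`_0|.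
  by apply: IHs => t ts; apply: hs; rewrite in_cons ts orbT.
have r_ge : d <= `|r| by rewrite hs ?mem_head.
rewrite big_cons /= exprS; move: IHs; set q := \prod_(_ <- _) _ => IHs.
set B := (1 + d^-1) ^+ size s in IHs *.
have B0 : 0 <= B by rewrite exprn_ge0 // addr_ge0 // ltW // invr_gt0.
rewrite !mulrBl !coefB !coefXM !coefCM eqxx sub0r normrN normrM.
rewrite (le_trans (ler_normB _ _)) // normrM.
(* The first summand pays for the coefficient shifted by ['X], as |r| / d is at least 1; the second
   pays for the coefficient multiplied by r. *)
have -> : (1 + d^-1) * B * (`|r| * `|q`_0|) =
   (d^-1 * `|r|) * (B * `|q`_0|) + `|r| * (B * `|q`_0|) by ring.
rewrite lerD ?ler_wpM2l // ?normr_ge0 //.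
apply: (@le_trans _ _ (B * `|q`_0|)).
  by case: ifP => _ //; rewrite normr0 mulr_ge0.
by rewrite ler_peMl ?mulr_ge0 // mulrC ler_pdivlMr // mul1r.
Qed.

(** Continuity at 0 by hand: on 0 < e < 1 both polynomials differ from their values at 0 by at most
    a constant times e, so |p(0)| is at most a constant times e. *)
Lemma horner_near0_le p q (B : C) :
  (forall e : R, 0 < e < 1 -> `|p.[e%:C]| <= B * `|q.[e%:C]|) ->
  q.[0] = 0 -> p.[0] = 0.
Proof.
move=> hpq /eqP/factor_theorem[q1]; rewrite subr0 => qE.
have /factor_theorem[p1] : root (p - (p.[0])%:P) 0 by rewrite /root !hornerE subrr.
rewrite subr0 => /eqP; rewrite subr_eq => /eqP pE.
have bnd f : exists2 M : R, 0 < M & forall e : R, 0 < e < 1 -> `|f.[e%:C]| <= M%:C.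
  have M0 : 0 <= \sum_(k < size f) `|f`_k| by rewrite sumr_ge0.
  exists (1 + Re (\sum_(k < size f) `|f`_k|)).
    by move: M0; rewrite lecE /= => /andP[_ M0]; rewrite ltr_wpDr.
  move=> e /andP[e0 e1]; rewrite horner_coef (le_trans (ler_norm_sum _ _ _)) //.
  rewrite rmorphD /= RRe_real ?ger0_real // -[leLHS]add0r lerD ?ler01 //.
  apply: ler_sum => k _; rewrite normrM ler_piMr // normrX exprn_ile1 //.
  by rewrite normc_def /= expr0n addr0 sqrtr_sqr lecR ger0_norm ltW.
have [M M0 hM] := bnd p1; have [N N0 hN] := bnd q1.
apply/eqP; apply: contraT => p00.
have /complex_realP[a aE] : `|p.[0]| \is Num.real by rewrite normr_real.
have a0 : 0 < a by rewrite -ltcR -aE normr_gt0.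
pose b : R := `|Re B| + 1; have b0 : 0 < b by rewrite /b ltr_wpDl.
have key (e : R) : 0 < e < 1 -> a <= e * (M + b * N).
  move=> e01; have [e0 _] := andP e01.
  have {hpq} := hpq e e01; rewrite qE {1}pE !hornerE => H.
  have H1 : `|p.[0]| <= `|p1.[e%:C] * e%:C + p.[0]| + `|p1.[e%:C]| * `|e%:C|.
    by rewrite -[leLHS](congr1 Num.norm (addKr (p1.[e%:C] * e%:C) _)) -normrM
       addrC (le_trans (ler_normD _ _)) // normrN.
  have {H1} := le_trans H1 (lerD H (lexx _)).
  rewrite normrM; have -> : `|e%:C| = e%:C.
    by rewrite normc_def /= expr0n addr0 sqrtr_sqr ger0_norm // ltW.
  move: (hM e e01) (hN e e01).
  have /complex_realP[u ->] : `|p1.[e%:C]| \is Num.real by rewrite normr_real.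
  have /complex_realP[v vE] : `|q1.[e%:C]| \is Num.real by rewrite normr_real.
  have v0 : 0 <= v by rewrite -ler0c -vE.
  rewrite vE aE !lecR => uM vN.
  rewrite lecE => /andP[_]; rewrite !cE /= => H1.
  have H2 := ler_norm (Re B).
  have H3 : Re B * (v * e) <= b * (N * e).
    apply: (@le_trans _ _ (b * (v * e))).
      by rewrite ler_wpM2r ?mulr_ge0 ?(ltW e0) // /b; lra.
    by rewrite ler_wpM2l ?(ltW b0) // ler_wpM2r ?(ltW e0).
  have : u * e <= M * e by rewrite ler_wpM2r // ltW.
  by move: H1; rewrite !(mulr0, mul0r, subr0, add0r, addr0); lra.
have MN : 0 < M + b * N by rewrite addr_gt0 // mulr_gt0.
have D0 : 0 < 2 * (M + b * N + a) by lra.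
(* The summand [a] in the denominator keeps this parameter below 1, while its product with
   [M + b * N] stays below [a]. *)
have := key (a / (2 * (M + b * N + a))).
rewrite divr_gt0 //= ltr_pdivrMr // mul1r.
have -> : a < 2 * (M + b * N + a) by lra.
move=> /(_ isT); rewrite mulrAC ler_pdivlMr //; nra.
Qed.

(** The coefficients of the family are polynomials in the parameter. By [coefs_le_coef0] all Taylor
    coefficients at [z0] are bounded by a fixed multiple of the value at [z0]; if that value tends
    to 0, so do they all. *)
Lemma hurwitz N (c : nat -> {poly C}) z0 (d : C) : 0 < d ->
  (forall e : R, 0 < e < 1 ->
     forall r, root (\poly_(k < N) (c k).[e%:C]) r -> d <= `|r - z0|) ->
  (\poly_(k < N) (c k).[0]).[z0] = 0 -> \poly_(k < N) (c k).[0] = 0.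
Proof.
move=> d0 hc; pose P e := \poly_(k < N) (c k).[e]; rewrite -/(P 0) => P0.
pose D j := \sum_(k < N) (('X + z0%:P) ^+ k)`_j *: c k.
have DE e j : (P e \Po ('X + z0%:P))`_j = (D j).[e].
  rewrite /P poly_def raddf_sum /= coef_sum horner_sum; apply: eq_bigr => k _.
  by rewrite comp_polyZ comp_Xn_poly !coefZ hornerZ mulrC.
suff : P 0 \Po ('X + z0%:P) = 0.
  move=> /(congr1 (fun q => q \Po ('X - z0%:P))).
  by rewrite comp_polyXaddC_K comp_poly0.
apply/polyP => j; rewrite coef0 DE.
apply: (@horner_near0_le _ (D 0%N) ((1 + d^-1) ^+ N)); last first.
  by rewrite -DE -horner_coef0 horner_comp !hornerE.
move=> e e01; rewrite -!DE.
set Q := P _ \Po _; have sQ : (size Q <= N)%N.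
  by rewrite size_comp_poly2 ?size_poly // size_XaddC.
apply: le_trans (coefs_le_coef0 j d0 _) _.
  move=> r; rewrite /root horner_comp !hornerE => Pr.
  by have := hc e e01 (r + z0); rewrite addrK; apply.
rewrite ler_wpM2r // ler_weXn2l ?lerDl ?invr_ge0 ?ltW //.
by rewrite (leq_trans (leq_pred _)).
Qed.

Lemma hurwitz_half (s : R) N (c : nat -> {poly C}) : s != 0 ->
  (forall e : R, 0 < e < 1 -> forall z, 0 < s * Im z ->
     (\poly_(k < N) (c k).[e%:C]).[z] != 0) ->
  \poly_(k < N) (c k).[0] = 0 \/
  (forall z, 0 < s * Im z -> (\poly_(k < N) (c k).[0]).[z] != 0).
Proof.
move=> s0 hc; have [->|P0] := eqVneq (\poly_(k < N) (c k).[0]) 0; [by left|right].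
move=> z sz; apply: contra P0 => /eqP Pz; apply/eqP.
have z0 : Im z != 0 by apply: contraTneq sz => ->; rewrite mulr0 ltxx.
(* The distance from [z] to the real axis is the radius of a disc inside the root-free
   half-plane. *)
apply: (@hurwitz N c z (`|Im z|%:C)) => //; first by rewrite ltcR normr_gt0.
move=> e e01 r Pr; have sr : s * Im r <= 0.
  by rewrite leNgt; apply/negP => /(hc e e01); rewrite (rootP Pr) eqxx.
rewrite distrC; case: (ltrgt0P s) s0 sz sr => // s0 _.
  rewrite pmulr_rgt0 // pmulr_rle0 // => zp rn.
  by rewrite gtr0_norm // normc_ge_Im ?(ltW zp) // !cE; lra.
rewrite nmulr_rgt0 // nmulr_rle0 // => zp rn.
by rewrite ltr0_norm // normc_geN_Im ?oppr_ge0 ?(ltW zp) // !cE; lra.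
Qed.
End Hurwitz.

Lemma sum_le0_exists (R : realDomainType) (T : eqType) (s : seq T) (f : T -> R) :
  s != [::] -> \sum_(i <- s) f i <= 0 -> exists2 i, i \in s & f i <= 0.
Proof.
elim: s => // i s IHs _; rewrite big_cons => sum_le0.
have [fi|fi] := leP (f i) 0; first by exists i; rewrite ?mem_head.
have [s0|/IHs] := eqVneq s [::]; first by rewrite s0 big_nil addr0 leNgt fi in sum_le0.
case=> [|j js fj]; first by rewrite -(lerD2l (f i)) addr0 (le_trans sum_le0) ?ltW.
by exists j; rewrite // in_cons js orbT.
Qed.

(** * The Grace-Walsh-Szego theorem *)

Section Grace.
Variable R : rcfType.
Notation C := R[i].
Implicit Types (x y z u : C) (p q P Q : {poly C}).

Variable A : R -> Prop.
Hypothesis convexA : forall s t w, A s -> A t -> s <= w <= t -> A w.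

Definition lowerU z := Im z < 0 \/ (Im z = 0 /\ A (Re z)).

(** The logarithmic derivative of the product at 0. *)
Lemma coef1_prod_XsubC (s : seq C) : 0 \notin s ->
  (\prod_(r <- s) ('X - r%:P))`_1 =
  - (\prod_(r <- s) ('X - r%:P))`_0 * \sum_(r <- s) r^-1.
Proof.
elim: s => [|r s IHs]; first by rewrite !big_nil coef1 mulr0.
rewrite in_cons negb_or eq_sym => /andP[r0 /IHs]; rewrite !big_cons.
set q := \prod_(_ <- s) _ => E.
rewrite !mulrBl !coefB !coefXM !coefCM /= E; field; exact: r0.
Qed.

Lemma Re_sum (T : Type) (s : seq T) (f : T -> C) :
  Re (\sum_(i <- s) f i) = \sum_(i <- s) Re (f i).
Proof. by apply: (big_morph (fun x : C => Re x)) => // x y; rewrite Re_addc. Qed.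

Lemma Im_sum (T : Type) (s : seq T) (f : T -> C) :
  Im (\sum_(i <- s) f i) = \sum_(i <- s) Im (f i).
Proof. by apply: (big_morph (fun x : C => Im x)) => // x y; rewrite Im_addc. Qed.

(* Zeros [h] of [g] satisfy [sum 1/h = N/u], whereas the complement of [lowerU],
   seen from [z] through [h |-> 1/h], is convex. *)
Lemma laguerre N (s : seq C) z u : (size s <= N)%N -> (0 < N)%N -> u != 0 ->
  lowerU z -> lowerU (z + u) -> (forall h, h \in s -> ~ lowerU (z + h)) ->
  \sum_(h <- s) h^-1 != N%:R / u.
Proof.
move=> sN N0 u0 Kz Kzu Ks; apply/eqP => E.
have N0' : 0 < N%:R :> R by rewrite ltr0n.
have sN' : (size s)%:R <= N%:R :> R by rewrite ler_nat.
have NE : N%:R = (N%:R : R)%:C by rewrite rmorph_nat.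
have s0 : s != [::].
  apply: contra_eq_neq E => ->; rewrite big_nil eq_sym mulf_neq0 ?invr_eq0 //.
  by rewrite pnatr_eq0 -lt0n.
have h0 h : h \in s -> h != 0.
  by move=> hs; apply: contraPneq (Ks h hs) => ->; rewrite addr0.
have ReE : \sum_(h <- s) Re h^-1 = N%:R * Re u^-1.
  by rewrite -Re_sum E NE Re_mulc /= mul0r subr0.
have ImE : \sum_(h <- s) Im h^-1 = N%:R * Im u^-1.
  by rewrite -Im_sum E NE Im_mulc /= mul0r addr0.
have Imh h : h \in s -> 0 <= Im z + Im h.
  by move=> /Ks K; rewrite leNgt; apply/negP => K'; apply: K; left; rewrite Im_addc.
have Imu : Im z + Im u <= 0 by case: Kzu => [/ltW|[+ _]]; rewrite Im_addc // => ->.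
have [v vE] : {v | v = u^-1} by exists u^-1.
have uE : u = v^-1 by rewrite vE invrK.
have nu := nsq_gt0 u; rewrite u0 in nu.
have nv : nsq v * nsq u = 1 by rewrite vE nsqV mulVf // gt_eqF.
have Imv : Im v * nsq u = - Im u by rewrite vE Im_invc mulfVK // gt_eqF.
have Rev : Re v * nsq u = Re u by rewrite vE Re_invc mulfVK // gt_eqF.
rewrite -vE in ReE ImE.
(* For [z] below the real axis the points 1/h lie in a closed disc with 0 on its boundary, and [v] =
   1/u lies outside its interior. Zeros missing from the count [N] sit at infinity and contribute
   1/h = 0. As the mean is [v], the sum of the squared distances to [v], weighted by - Im z > 0, is
   at most 0; so some 1/h equals [v], although z + u lies in [lowerU]. *)
case: Kz => [zlow|[z0 Az]].
  have [h hs] : exists2 h, h \in s & - Im z * nsq (h^-1 - v) <= 0.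
    apply: sum_le0_exists => //.
    rewrite (eq_bigr (fun h => - Im z * nsq h^-1 + (2 * Im z * Re v) * Re h^-1 +
       (2 * Im z * Im v) * Im h^-1 + - Im z * nsq v)); last first.
      by move=> h _; rewrite /nsq !cE; ring.
    rewrite !big_split /= -!mulr_sumr ReE ImE.
    have -> : \sum_(h <- s) nsq v = nsq v * (size s)%:R.
      by rewrite big_const_seq count_predT iter_addr addr0 mulr_natr.
    have : \sum_(h <- s) - Im z * nsq h^-1 <= \sum_(h <- s) - Im h^-1.
      rewrite big_seq [leRHS]big_seq; apply: ler_sum => h hs.
      have := Imh h hs; have nh := nsq_gt0 h; rewrite h0 // in nh.
      rewrite Im_invc nsqV -mulNr opprK ler_pM2r ?invr_gt0 //; lra.
    rewrite sumrN ImE -!mulr_sumr; set S := \sum_(h <- s) nsq _.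
    have Imv' : - Im v <= - Im z * nsq v.
      have -> : - Im v = Im u * nsq v by rewrite -[Im u]opprK -Imv mulNr -mulrA [nsq u * _]mulrC nv mulr1.
      by rewrite ler_wpM2r ?nsq_ge0 //; lra.
    have : - Im z * nsq v * (size s)%:R <= - Im z * nsq v * N%:R.
      by rewrite ler_wpM2l // mulr_ge0 ?nsq_ge0 //; lra.
    have : N%:R * - Im v <= N%:R * (- Im z * nsq v) by rewrite ler_wpM2l ?(ltW N0').
    rewrite /nsq; lra.
  rewrite pmulr_rle0 ?oppr_gt0 // => nhv.
  have : nsq (h^-1 - v) == 0 by rewrite eq_le nhv nsq_ge0.
  rewrite nsq_eq0 subr_eq0 vE => /eqP/invr_inj hu.
  by case: (Ks h hs); rewrite hu.
(* For real [z] the disc degenerates to the closed lower half-plane, and [v] lies in the closed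
   upper one. Hence [v] and all the 1/h are real. *)
have Imv_ge0 : 0 <= Im v by nra.
have Imh_inv h : h \in s -> Im h^-1 <= 0.
  move=> hs; rewrite Im_invc mulNr oppr_le0 mulr_ge0 ?invr_ge0 ?nsq_ge0 //.
  by have := Imh h hs; rewrite z0 add0r.
have Imh_inv0 : {in s, forall h, Im h^-1 = 0}.
  have : \sum_(h <- s | h \in s) - Im h^-1 == 0.
    rewrite -big_seq sumrN ImE oppr_eq0 eq_le (mulr_ge0 (ltW N0')) // andbT -ImE.
    by rewrite big_seq sumr_le0.
  rewrite psumr_eq0; last by move=> h /Imh_inv; rewrite oppr_ge0.
  by move=> /allP Hs h hs; have := Hs h hs; rewrite hs /= oppr_eq0 => /eqP.
have Imv0 : Im v = 0.
  have /eqP := ImE; rewrite big_seq big1 // eq_sym mulf_eq0 gt_eqF //=.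
  by move/eqP.
have Imu0 : Im u = 0 by apply/eqP; rewrite -oppr_eq0 -Imv Imv0 mul0r.
have Au : A (Re z + Re u).
  by case: Kzu; rewrite Im_addc z0 Imu0 addr0 ?ltxx // => -[_]; rewrite Re_addc.
(* Averaging yields some 1/h with v/h >= v^2. Then z + h lies between z and z + u, and convexity of
   [A] puts it into [lowerU]. *)
have [h hs] : exists2 h, h \in s & Re v * (Re v - Re h^-1) <= 0.
  apply: sum_le0_exists => //.
  rewrite -mulr_sumr big_split /= sumrN ReE.
  have -> : \sum_(h <- s) Re v = Re v * (size s)%:R.
    by rewrite big_const_seq count_predT iter_addr addr0 mulr_natr.
  have -> : Re v * (Re v * (size s)%:R - N%:R * Re v) =
    - (Re v ^+ 2 * (N%:R - (size s)%:R)) by ring.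
  by rewrite oppr_le0 mulr_ge0 ?sqr_ge0 // subr_ge0.
have nh := nsq_gt0 h; rewrite h0 // in nh.
have Imh0 : Im h = 0.
  have /eqP := Imh_inv0 h hs; rewrite Im_invc mulf_eq0 invr_eq0 (gt_eqF nh) orbF.
  by rewrite oppr_eq0 => /eqP.
have wr : Re h^-1 * Re h = 1.
  by rewrite Re_invc mulrAC -expr2 -[X in X / _]addr0 -[0](expr0n R 2) -Imh0 divff ?gt_eqF.
have vt : Re v * Re u = 1.
  by rewrite vE Re_invc mulrAC -expr2 -[X in X / _]addr0 -[0](expr0n R 2) -Imu0 divff ?gt_eqF.
move: (Re h^-1) wr => w wr vw.
have Ah : A (Re z + Re h).
  have rt : Re u - Re h = Re h * Re u * (w - Re v).
    transitivity (Re u * (w * Re h) - Re h * (Re v * Re u)); last by ring.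
    by rewrite wr vt !mulr1.
  case: (ltrgt0P (Re u)) => tt; last by have := oner_eq0 R; rewrite -vt tt mulr0 eqxx.
    apply: (convexA Az Au); rewrite lerDl lerD2l -[_ <= Re u]subr_ge0 rt.
    have v_gt0 : 0 < Re v by rewrite -(pmulr_lgt0 _ tt) vt.
    have wv : Re v <= w by rewrite -subr_le0 -(pmulr_rle0 _ v_gt0).
    have r_gt0 : 0 < Re h by rewrite -(pmulr_rgt0 _ (lt_le_trans v_gt0 wv)) wr.
    by rewrite ltW // !mulr_ge0 ?subr_ge0 // ltW.
  apply: (convexA Au Az); rewrite gerDl lerD2l -[Re u <= _]subr_ge0 -opprB rt.
  have v_lt0 : Re v < 0 by rewrite -(nmulr_lgt0 _ tt) vt.
  have wv : w <= Re v by rewrite -subr_ge0 -(nmulr_rle0 _ v_lt0).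
  have r_lt0 : Re h < 0 by rewrite -(nmulr_rgt0 _ (le_lt_trans wv v_lt0)) wr.
  by rewrite (ltW r_lt0) andbT -mulrN mulr_ge0 ?oppr_ge0 ?subr_le0 // nmulr_rge0 // ltW.
by case: (Ks h hs); right; rewrite Im_addc Re_addc z0 Imh0 addr0.
Qed.

End Grace.

Section GraceWalshSzego.
Variable R : rcfType.
Notation C := R[i].
Implicit Types (x y z u : C) (p q P Q : {poly C}).

(** Turns [L] on powers of linear forms into a polynomial in the displacement [h] of the root, whose
    zeros [laguerre] then constrains. *)
Lemma XsubC_expn_shift (L : {scalar {poly C}}) N z h :
  (\poly_(j < N.+1) (((-1) ^+ j * L (('X - z%:P) ^+ (N - j))) *+ 'C(N, j))).[h] =
  L (('X - (z + h)%:P) ^+ N).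
Proof.
rewrite rmorphD opprD addrA exprBn linear_sum horner_poly; apply: eq_bigr => j _.
set q := ('X - z%:P) ^+ _.
have -> : (-1) ^+ j * q * h%:P ^+ j = ((-1) ^+ j * h ^+ j) *: q.
  by rewrite -mul_polyC rmorphM !rmorphXn rmorphN rmorph1 /= mulrAC.
by rewrite linearMn linearZ /= mulrnAl mulrAC.
Qed.

(** Freezing a root z1 replaces [L] by [premul ('X - z1%:P) L], used on polynomials of one degree
    less. *)
Definition premul (a : {poly C}) (L : {scalar {poly C}}) p := L (a * p).

Lemma premul_is_scalar a L : scalar (premul a L).
Proof. by move=> c p q; rewrite /premul mulrDr -scalerAr linearP. Qed.

HB.instance Definition _ a L :=
  GRing.isLinear.Build C {poly C} C _ (premul a L) (premul_is_scalar a L).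

Variable A : R -> Prop.
Hypothesis convexA : forall s t w, A s -> A t -> s <= w <= t -> A w.

(** Each round of the induction freezes one root. The new functional is again nonzero on powers,
    with exponent lowered by one, because its value there is a polar derivative of the old one. *)
Theorem grace_walsh_szego (L : {scalar {poly C}}) (s : seq C) :
  (forall z, lowerU A z -> L (('X - z%:P) ^+ size s) != 0) ->
  (forall z, z \in s -> lowerU A z) -> L (\prod_(z <- s) ('X - z%:P)) != 0.
Proof.
elim: s L => [|z1 s IHs] L hL hs.
  by have := hL (- 'i); rewrite big_nil expr0; apply; left; rewrite /= oppr_lt0 ltr01.
rewrite big_cons -/(premul _ _ _); apply: IHs; last first.
  by move=> z zs; apply: hs; rewrite in_cons zs orbT.
move=> z Kz; change (L (('X - z1%:P) * ('X - z%:P) ^+ size s) != 0).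
have Kz1 : lowerU A z1 by apply: hs; rewrite mem_head.
set N := size s; pose g := \poly_(j < N.+2) (((-1) ^+ j * L (('X - z%:P) ^+ (N.+1 - j))) *+ 'C(N.+1, j)).
have gE h : g.[h] = L (('X - (z + h)%:P) ^+ N.+1) by rewrite XsubC_expn_shift.
have g0E : g`_0 = L (('X - z%:P) ^+ N.+1) by rewrite -horner_coef0 gE addr0.
have g1E : g`_1 = - L (('X - z%:P) ^+ N) *+ N.+1.
  by rewrite coef_poly /= bin1 subSS subn0 expr1 mulN1r.
have g0 : g`_0 != 0 by rewrite g0E hL.
have [->|zz1] := eqVneq z1 z; first by rewrite -exprS -g0E.
have [r gr] := closed_field_poly_normal g.
have lc0 : lead_coef g != 0 by rewrite lead_coef_eq0; apply: contraNneq g0 => ->; rewrite coef0.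
have gh h : h \in r -> g.[h] = 0.
  by rewrite gr hornerZ -root_prod_XsubC => /rootP->; rewrite mulr0.
have r0 : 0 \notin r by apply: contra g0 => /gh; rewrite -horner_coef0 => ->.
have sr : (size r <= N.+1)%N.
  have : (size g <= N.+2)%N by rewrite size_poly.
  by rewrite gr size_scale // size_prod_XsubC.
have u0 : z1 - z != 0 by rewrite subr_eq0.
have := @laguerre _ _ convexA N.+1 r z (z1 - z) sr isT u0 Kz.
rewrite addrC subrK => /(_ Kz1) H; have {}H := H _.
have g10 : g`_1 = - g`_0 * \sum_(h <- r) h^-1.
  by rewrite gr !coefZ coef1_prod_XsubC // !mulNr mulrN mulrA.
(* The polar derivative: it vanishes only if the logarithmic derivative of [g] at 0 is -(N+1)/(z1 -
   z), that is, if the sum of the 1/h takes the value which [laguerre] excludes. *)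
have -> : L (('X - z1%:P) * ('X - z%:P) ^+ N) =
    g`_0 + (z1 - z) * g`_1 / N.+1%:R.
  rewrite g0E g1E -[X in _ * X / _]mulr_natr mulrA mulfK ?pnatr_eq0 // mulrN.
  have -> : ('X - z1%:P) * ('X - z%:P) ^+ N =
      ('X - z%:P) ^+ N.+1 - (z1 - z) *: ('X - z%:P) ^+ N.
    by rewrite exprS -mul_polyC -mulrBl polyCB; congr (_ * _); ring.
  by rewrite linearB linearZ.
have Hr h : h \in r -> ~ lowerU A (z + h).
  by move=> hr K; have := hL _ K; rewrite /= -/N -gE gh ?eqxx.
apply: contraNneq (H Hr) => E; set S := \sum_(h <- r) _ in g10 *.
have : g`_0 * (N.+1%:R - (z1 - z) * S) = 0.
  have N0 : N.+1%:R != 0 :> C by rewrite pnatr_eq0.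
  transitivity (N.+1%:R * (g`_0 + (z1 - z) * g`_1 / N.+1%:R)); last by rewrite E mulr0.
  by rewrite g10; move: (g`_0) (N.+1%:R) N0 => c M M0; field.
move=> /eqP; rewrite mulf_eq0 (negPf g0) /= subr_eq0 => /eqP->.
by rewrite mulrC mulKf.
Qed.

(** A Rouche estimate on an unbounded region. With d the distance from [z0] to the real axis, |r -
    z0| >= d gives |g(r)| <= B |r - z0|^n, because [g] has degree at most n; so |c| B < 1 leaves no
    root there. The summand |g_n| of [B] protects the degree. *)
Lemma perturb_lower z0 (g : {poly C}) n : Im z0 < 0 -> (size g <= n.+1)%N ->
  exists2 e : R, 0 < e & forall c : C, `|c| <= e%:C ->
    let P := ('X - z0%:P) ^+ n + c *: g in
    size P = n.+1 /\ forall r, root P r -> Im r < 0.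
Proof.
move=> z0low sg; pose d := (- Im z0)%:C : C.
have d0 : 0 < d by rewrite ltcR oppr_gt0.
pose g1 := g \Po ('X + z0%:P).
have sg1 : (size g1 <= n.+1)%N by rewrite size_comp_poly2 ?size_XaddC.
pose B : C := \sum_(k < n.+1) `|g1`_k| * d^-1 ^+ (n - k) + `|g`_n|.
have B1 : 0 <= \sum_(k < n.+1) `|g1`_k| * d^-1 ^+ (n - k).
  by apply: sumr_ge0 => k _; rewrite mulr_ge0 // exprn_ge0 // invr_ge0 ltW.
have B0 : 0 <= B by rewrite addr_ge0.
have /complex_realP[b bE] : B \is Num.real by rewrite ger0_real.
have b0 : 0 <= b by rewrite -ler0c -bE.
exists (1 + b)^-1; first by rewrite invr_gt0 ltr_wpDr.
move=> c hc; set P := _ + _ => /=.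
have cB : `|c| * B < 1.
  apply: (@le_lt_trans _ _ ((1 + b)^-1%:C * B)); first by rewrite ler_wpM2r.
  rewrite bE -rmorphM ltcR mulrC ltr_pdivrMr ?mul1r; lra.
have monP : ('X - z0%:P) ^+ n \is monic by rewrite monic_exp ?monicXsubC.
have sPn : size (('X - z0%:P) ^+ n) = n.+1 by rewrite size_exp_XsubC.
split.
  apply/eqP; rewrite eqn_leq; apply/andP; split.
    by rewrite (leq_trans (size_polyD _ _)) // geq_max sPn leqnn (leq_trans (size_scale_leq _ _)).
  rewrite ltnNge; apply/negP => sP.
  have : P`_n = 0 by rewrite nth_default.
  rewrite coefD coefZ; have -> : (('X - z0%:P) ^+ n)`_n = 1.
    by have := monicP monP; rewrite lead_coefE sPn.
  move=> /eqP; rewrite addrC addr_eq0 => /eqP/(congr1 Num.norm).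
  rewrite normrN normr1 normrM => E.
  have /le_lt_trans/(_ cB) : 1 <= `|c| * B by rewrite -E ler_wpM2l // lerDr.
  by rewrite ltxx.
move=> r Pr; rewrite ltNge; apply/negP => r0.
have dh : d <= `|r - z0|.
  by apply: normc_ge_Im; rewrite ?oppr_ge0 ?(ltW z0low) // !cE; lra.
have h0 : 0 < `|r - z0| := lt_le_trans d0 dh.
have : `|g.[r]| <= (\sum_(k < n.+1) `|g1`_k| * d^-1 ^+ (n - k)) * `|r - z0| ^+ n.
  have -> : g.[r] = g1.[r - z0] by rewrite horner_comp !hornerE subrK.
  rewrite (horner_coef_wide _ sg1) mulr_suml (le_trans (ler_norm_sum _ _ _)) //.
  apply: ler_sum => k _; rewrite normrM normrX -mulrA ler_wpM2l //.
  rewrite -[X in _ <= _ * _ ^+ X](subnK (leq_ord k)) exprD mulrA -exprMn ler_peMl //.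
    by rewrite exprn_ge0.
  by rewrite exprn_ege1 // mulrC ler_pdivlMr // mul1r.
move=> gr; move: Pr; rewrite /root /P !hornerE addr_eq0 => /eqP.
move=> /(congr1 Num.norm); rewrite normrN normrX normrM => E.
have : `|r - z0| ^+ n < `|r - z0| ^+ n.
  rewrite {1}E (@le_lt_trans _ _ (`|c| * B * `|r - z0| ^+ n)) //.
    rewrite -mulrA ler_wpM2l // (le_trans gr) // ler_wpM2r ?exprn_ge0 //.
    by rewrite lerDl.
  by rewrite gtr_pMl ?exprn_gt0.
by rewrite ltxx.
Qed.
End GraceWalshSzego.

(** * From a stable symbol to preservation of roots *)

Section Evaluation.
Variable R : rcfType.
Notation C := R[i].
Implicit Types (x y z u : C) (p q : {poly C}) (Q : CP1 R).

Lemma complexi_neq0 : 'i != 0 :> C.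
Proof. by rewrite eq_complex /= oner_eq0 andbF. Qed.

(** The polynomial is read as a form of degree [m], whose value at (1 : 0) is its coefficient of
    degree [m]; a root at infinity is a drop in degree. *)
Definition pev m p Q := if Q is Some t then p.[t] else p`_m.

Definition evalT (T : {linear {poly C} -> {poly C}}) m Q p := pev m (T p) Q.

Lemma evalT_is_scalar T m Q : scalar (evalT T m Q).
Proof.
move=> c p q; rewrite /evalT linearP; case: Q => [t|] /=; by rewrite ?hornerE ?coefE.
Qed.

HB.instance Definition _ T m Q :=
  GRing.isLinear.Build C {poly C} C _ (evalT T m Q) (evalT_is_scalar T m Q).

Lemma pevZ m c p Q : pev m (c *: p) Q = c * pev m p Q.
Proof. by case: Q => [t|]; rewrite /= ?hornerZ ?coefZ. Qed.

Lemma pevJ m p Q : pev m (conjp p) Q = (pev m p (omap conjc Q))^*.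
Proof. by case: Q => [t|]; rewrite /= ?horner_conjp ?coef_map. Qed.

(* The closed upper (0 < s) or lower (s < 0) half-plane. *)
Definition closed_half (s : R) Q := if Q is Some t then 0 <= s * Im t else true.

Lemma closed_halfVJ s Q : closed_half s Q \/ closed_half s (omap conjc Q).
Proof.
case: Q => [t|] /=; last by left.
by rewrite Im_conjc mulrN oppr_ge0; case: (leP 0 (s * Im t)) => [|/ltW]; [left|right].
Qed.

Lemma linear_sum_coef (V : lmodType C) (T : {linear {poly C} -> V}) N p :
  (size p <= N)%N -> T p = \sum_(j < N) p`_j *: T 'X^j.
Proof.
move=> sp; rewrite [p in LHS](_ : p = \poly_(j < N) p`_j).
  by rewrite poly_def linear_sum; apply: eq_bigr => j _; rewrite linearZ.
apply/polyP => k; rewrite coef_poly; case: ltnP => // Nk.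
by rewrite nth_default // (leq_trans sp).
Qed.

End Evaluation.

Section StableSymbol.
Variable R : rcfType.
Notation C := R[i].
Implicit Types (x y z u : C) (p q : {poly C}) (Q : CP1 R).

Variables (n m : nat) (T : {linear {poly C} -> {poly C}}).
Hypothesis size_T : forall p, (size (T p) <= m.+1)%N.
Hypothesis conj_T : forall p, T (conjp p) = conjp (T p).

Variable A : R -> Prop.
Hypothesis convexA : forall s t w, A s -> A t -> s <= w <= t -> A w.
Variable J : R -> Prop.
Let JP Q := exists2 x, J x & Q = Some x%:C.

Variable s : R.
Hypothesis s0 : s != 0.
Hypothesis stableT : forall z Q, lowerU A z -> closed_half s Q -> ~ JP Q ->
  pev m (T (('X - z%:P) ^+ n)) Q != 0.

Lemma stable_prod (r : seq C) Q : size r = n -> (forall z, z \in r -> lowerU A z) ->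
  closed_half s Q -> ~ JP Q -> pev m (T (\prod_(z <- r) ('X - z%:P))) Q != 0.
Proof.
move=> sr hr sQ JQ; apply: (@grace_walsh_szego _ _ convexA (evalT T m Q)) => // z Kz.
by rewrite /= /evalT sr stableT.
Qed.

Lemma conjp_prod_real (r : seq R) :
  conjp (\prod_(t <- r) ('X - t%:C%:P)) = \prod_(t <- r) ('X - t%:C%:P).
Proof.
rewrite /conjp rmorph_prod; apply: eq_bigr => t _.
by rewrite rmorphB /= map_polyX map_polyC /= oppr0.
Qed.

(** Stability speaks of one half-plane only; the product and hence its image are real, so
    conjugation covers the other one. *)
Lemma stable_interval_rooted (r : seq R) Q : size r = n ->
  (forall t, t \in r -> A t) -> ~ JP Q ->
  pev m (T (\prod_(t <- r) ('X - t%:C%:P))) Q != 0.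
Proof.
move=> sr hr JQ; set p := \prod_(t <- r) _.
have main Q' : closed_half s Q' -> ~ JP Q' -> pev m (T p) Q' != 0.
  move=> sQ JQ'; have := @stable_prod [seq t%:C | t <- r] Q'.
  rewrite big_map; apply=> //; first by rewrite size_map.
  by move=> z /mapP[t /hr At ->]; right.
case: (closed_halfVJ s Q) => sQ; first exact: main.
rewrite -[p]conjp_prod_real conj_T pevJ conjc_eq0; apply: main => // -[x Jx].
case: Q JQ {sQ} => //= t JQ [E]; apply: JQ; exists x => //.
by rewrite -[t]conjcK E conjc_real.
Qed.

(** For e > 0 each root t is moved down to t - i e, and the n - size r roots at infinity are brought
    to 1/(i e) = -i/e. All n roots are then in the open lower half-plane, where Grace-Walsh-Szego
    applies; Hurwitz handles e -> 0. *)
Lemma stable_real_rooted (r : seq R) x : (size r <= n)%N -> Im x != 0 ->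
  T (\prod_(t <- r) ('X - t%:C%:P)) = 0 \/
  (T (\prod_(t <- r) ('X - t%:C%:P))).[x] != 0.
Proof.
move=> sr Imx; set p := \prod_(t <- r) _.
pose k := (n - size r)%N.
pose P : {poly {poly C}} := (\prod_(t <- r) ('X - (t%:C%:P - 'i *: 'X)%:P)) *
  (1 - ('i *: 'X)%:P * 'X) ^+ k.
pose Pe (e : C) := map_poly (horner_eval e) P.
have PeE e : Pe e = (\prod_(t <- r) ('X - (t%:C - 'i * e)%:P)) * (1 - ('i * e)%:P * 'X) ^+ k.
  rewrite /Pe /P rmorphM rmorphXn rmorph_prod /=; congr (_ * _ ^+ _).
    apply: eq_bigr => t _; rewrite rmorphB /= map_polyX map_polyC /=.
    by rewrite /horner_eval !hornerE.
  by rewrite rmorphB rmorph1 rmorphM /= map_polyX map_polyC /= /horner_eval !hornerE.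
have Pe0 : Pe 0 = p.
  rewrite PeE mulr0 mul0r subr0 expr1n mulr1; apply: eq_bigr => t _.
  by rewrite subr0.
(* The coefficient of degree j of the image of [Pe e], as a polynomial in e: the shape of family
   that [hurwitz_half] takes. *)
pose c j := \sum_(i < size P) (T 'X^i)`_j *: P`_i.
have cTE e : \poly_(j < m.+1) (c j).[e] = T (Pe e).
  rewrite (@linear_sum_coef _ _ T (size P)) ?size_poly //.
  apply/polyP => j; rewrite coef_poly coef_sum horner_sum; case: ltnP => [_|mj].
    by apply: eq_bigr => i _; rewrite hornerZ coefZ coef_map mulrC.
  rewrite big1 // => i _; rewrite coefZ [_`_j]nth_default ?mulr0 //.
  exact: leq_trans (size_T _) mj.
have [] := @hurwitz_half R s m.+1 c s0.
- move=> e /andP[e0 e1] z sz; rewrite cTE.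
  have e0' : e%:C != 0 :> C by rewrite (inj_eq (@complexI R)) gt_eqF.
  pose zs := [seq t%:C - 'i * e%:C | t <- r] ++ nseq k ('i * e%:C)^-1.
  have -> : Pe e%:C = (- 'i * e%:C) ^+ k *: \prod_(w <- zs) ('X - w%:P).
    rewrite PeE /zs big_cat /= big_map big_nseq iter_mulr_1 scalerAr -exprZn.
    congr (_ * _ ^+ _); rewrite scalerBr scale_polyC.
    have -> : - 'i * e%:C * ('i * e%:C)^-1 = -1 :> C.
      by rewrite !mulNr divff // mulf_neq0 ?complexi_neq0.
    by rewrite polyCN opprK addrC mulNr scaleNr mul_polyC.
  rewrite linearZ hornerZ mulf_neq0 //.
    by rewrite expf_neq0 // mulf_neq0 // oppr_eq0 complexi_neq0.
  apply: (@stable_prod zs (Some z)) => //.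
  + by rewrite size_cat size_map size_nseq subnKC.
  + move=> w; rewrite mem_cat => /orP[/mapP[t _ ->]|/nseqP[-> _]]; left.
      by rewrite !cE /= !mul0r; lra.
    by rewrite Im_invc mulNr oppr_lt0 divr_gt0 // ?nsq_gt0 ?mulf_neq0 ?complexi_neq0 //; rewrite ?cE /=; lra.
  + by rewrite /= ltW.
  + by case=> y _ [E]; rewrite E mulr0 ltxx in sz.
- by rewrite cTE Pe0; left.
rewrite cTE Pe0 => main; right.
have [sx|sx] := ltP 0 (s * Im x); first exact: main.
rewrite -[p]conjp_prod_real conj_T horner_conjp conjc_eq0 main //.
by rewrite Im_conjc mulrN oppr_gt0 lt_neqAle sx mulf_neq0.
Qed.

End StableSymbol.

Definition cpoly (R : rcfType) (p : {poly R}) : {poly R[i]} :=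
  map_poly (real_complex R) p.

HB.instance Definition _ (R : rcfType) :=
  GRing.RMorphism.copy (@cpoly R) (map_poly (real_complex R)).

(** * Real-rooted polynomials and pencils *)

Section RealRooted.
Variable R : rcfType.
Notation C := R[i].
Implicit Types (x y z u : C) (p q r g : {poly R}) (a b t : R).

Lemma coef_cpoly p k : (cpoly p)`_k = (p`_k)%:C.
Proof. exact: coef_map. Qed.

Lemma cpolyZ t p : cpoly (t *: p) = t%:C *: cpoly p.
Proof. exact: map_polyZ. Qed.

Lemma cpolyX : cpoly 'X = 'X :> {poly C}.
Proof. exact: map_polyX. Qed.

Lemma cpolyC t : cpoly t%:P = (t%:C)%:P.
Proof. exact: map_polyC. Qed.

Lemma lead_coef_cpoly p : lead_coef (cpoly p) = (lead_coef p)%:C.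
Proof. exact: lead_coef_map. Qed.

Lemma size_cpoly p : size (cpoly p) = size p.
Proof. exact: size_map_poly. Qed.

Lemma horner_cpoly p t : (cpoly p).[t%:C] = (p.[t])%:C :> C.
Proof. exact: horner_map. Qed.

Lemma conjp_cpoly p : conjp (cpoly p) = cpoly p :> {poly C}.
Proof. by apply/polyP => k; rewrite /conjp coef_map coef_cpoly /= oppr0. Qed.

Lemma horner_cpolyJ p x : (cpoly p).[conjc x] = conjc ((cpoly p).[x]).
Proof. by have := horner_conjp (cpoly p) (conjc x); rewrite conjp_cpoly conjcK. Qed.

Lemma cpoly_inj : injective (fun p => cpoly p : {poly C}).
Proof. exact: map_poly_inj. Qed.

Lemma conjp_eqE (P : {poly C}) : conjp P = P -> P = cpoly (map_poly Re P).
Proof.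
move=> PE; apply/polyP => k; rewrite coef_cpoly coef_map_id0 //=.
by apply/complex_eq => //=; apply/conjc_id; rewrite -[in RHS]PE coef_map.
Qed.

Definition real_rooted g := forall x, Im x != 0 -> (cpoly g).[x] != 0.

Lemma real_rooted_Im0 g x : real_rooted g -> (cpoly g).[x] = 0 -> Im x = 0.
Proof. by move=> hg gx; apply/eqP/negPn/negP => /hg; rewrite gx eqxx. Qed.

Lemma real_rooted_upper g :
  (forall x, 0 < Im x -> (cpoly g).[x] != 0) -> real_rooted g.
Proof.
move=> H x; case: (ltrgt0P (Im x)) => // x0 _; first exact: H.
by rewrite -[x]conjcK horner_cpolyJ conjc_eq0 H // Im_conjc oppr_gt0.
Qed.

Lemma real_rooted_neq0 g : real_rooted g -> g != 0.
Proof.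
move=> hg; apply: contraTneq (hg 'i _) => [->|]; last by rewrite /= oner_neq0.
by rewrite rmorph0 horner0 eqxx.
Qed.

Lemma real_rooted_factor g : real_rooted g ->
  exists s : seq R, g = lead_coef g *: \prod_(t <- s) ('X - t%:P).
Proof.
move=> hg; have [s sE] := closed_field_poly_normal (cpoly g : {poly C}).
exists [seq Re z | z <- s]; apply: cpoly_inj.
rewrite sE lead_coef_cpoly cpolyZ big_map rmorph_prod /=; congr (_ *: _).
rewrite big_seq [RHS]big_seq; apply: eq_bigr => z zs.
rewrite rmorphB /= cpolyX cpolyC /=; congr (_ - _%:P).
apply/complex_eq => //=; apply/eqP; apply: contraLR (zs) => Imz.
apply/negP => _; have := hg z Imz.
rewrite sE hornerZ; suff /rootP-> : root (\prod_(z0 <- s) ('X - z0%:P)) z by rewrite mulr0 eqxx.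
by rewrite root_prod_XsubC.
Qed.

(** The condition on the coefficient excludes a root at infinity. *)
Definition rooted_in m a b g := g`_m != 0 /\
  forall x, (cpoly g).[x] = 0 -> exists2 t, a <= t <= b & x = t%:C.

Lemma rooted_in_real m a b g : rooted_in m a b g -> real_rooted g.
Proof. by move=> [_ hg] x; apply: contra_neq => /hg[t _ ->]. Qed.

Lemma rooted_in_root m a b g t : rooted_in m a b g -> g.[t] = 0 -> a <= t <= b.
Proof.
move=> [_ hg] gt; have [|w wab /complexI ->//] := hg t%:C.
by rewrite horner_cpoly gt.
Qed.

Lemma rooted_in_factor m a b g : (size g <= m.+1)%N -> rooted_in m a b g ->
  exists s : seq R, [/\ size s = m, forall t, t \in s -> a <= t <= b &
    g = g`_m *: \prod_(t <- s) ('X - t%:P)].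
Proof.
move=> sg hg; have [s sE] := real_rooted_factor (rooted_in_real hg).
have g0 := real_rooted_neq0 (rooted_in_real hg).
have size_g : size g = m.+1.
  apply/eqP; rewrite eqn_leq sg ltnNge; apply/negP => sg'.
  by case: hg; rewrite nth_default ?eqxx.
have lcE : lead_coef g = g`_m by rewrite lead_coefE size_g.
exists s; rewrite -lcE; split=> //.
  by have := size_g; rewrite sE size_scale ?lead_coef_eq0 // size_prod_XsubC => -[].
move=> t ts; apply: (rooted_in_root hg); rewrite sE hornerZ.
suff /rootP-> : root (\prod_(z0 <- s) ('X - z0%:P)) t by rewrite mulr0.
by rewrite root_prod_XsubC.
Qed.

(** Bounds rather than mere signs: being affine in the polynomial, they later cut out the monic
    [a, b]-rooted members of a pencil and show that the parameters of these are bounded. *)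
Lemma horner_prod_bounds a b (s : seq R) (x : R) : (forall t, t \in s -> a <= t <= b) ->
  let q := \prod_(t <- s) ('X - t%:P) in
  (b < x -> (x - b) ^+ size s <= q.[x] <= (x - a) ^+ size s) /\
  (x < a -> (a - x) ^+ size s <= (-1) ^+ size s * q.[x]).
Proof.
elim: s => [|t s IHs] hs /=; first by rewrite big_nil !expr0 hornerE mul1r lexx.
have /andP[at_ tb] : a <= t <= b by rewrite hs ?mem_head.
have [|IHb IHa] := IHs; first by move=> w ws; apply: hs; rewrite in_cons ws orbT.
rewrite big_cons hornerM hornerXsubC !exprS; split=> hx.
  have /andP[IH1 IH2] := IHb hx.
  have h0 : 0 <= x - b by rewrite subr_ge0 ltW.
  have h1 : 0 <= (x - b) ^+ size s by rewrite exprn_ge0.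
  apply/andP; split; apply: ler_pM => //; try lra.
have h0 : 0 <= a - x by rewrite subr_ge0 ltW.
rewrite mulrACA mulN1r opprB ler_pM ?exprn_ge0 //; last exact: IHa.
lra.
Qed.

(** Hermite-Biehler for h = r + i q. If c q + d r vanishes at x, then q(x) and r(x) are proportional
    over the reals and |h(x)| = |h(conj x)|, which is impossible in the upper half-plane once h has
    a nonreal root. Otherwise h is a constant times a real polynomial, of which q and r are real
    multiples. *)
Lemma pencil_real_rooted q r (c d : R) :
  (forall x, 0 < Im x -> (cpoly r + 'i *: cpoly q).[x] != 0) ->
  c *: q + d *: r = 0 \/ real_rooted (c *: q + d *: r).
Proof.
set h := cpoly r + _ => hx; set f := c *: q + _.
have hE x : h.[x] = (cpoly r).[x] + 'i * (cpoly q).[x] by rewrite !hornerE.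
have hJ x : conjc (h.[conjc x]) = (cpoly r).[x] - 'i * (cpoly q).[x].
  rewrite hE !horner_cpolyJ rmorphD rmorphM /= !conjcK; congr (_ + _).
  by rewrite -mulNr; congr (_ * _); apply/complex_eq; rewrite /= ?oppr0.
have h0 : h != 0.
  by apply: contraTneq (hx 'i ltr01) => ->; rewrite horner0 eqxx.
have h_low z : root h z -> Im z <= 0.
  by move=> /rootP hz; rewrite leNgt; apply/negP => /hx; rewrite hz eqxx.
have fE x : (cpoly f).[x] = c%:C * (cpoly q).[x] + d%:C * (cpoly r).[x].
  by rewrite rmorphD /= !cpolyZ /= !hornerE.
have [|hreal] := EM (exists2 z, root h z & Im z < 0).
  move=> [z hz z0]; have [->|f0] := eqVneq f 0; [by left|right].
  have [cd0|cd0] := boolP ((c == 0) && (d == 0)).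
    by case/andP: cd0 f0 => /eqP c0 /eqP d0; rewrite /f c0 d0 !scale0r addr0 eqxx.
  suff H x : 0 < Im x -> (cpoly f).[x] != 0.
    exact: real_rooted_upper.
  move=> x0; apply/eqP; rewrite fE => E.
  have := nsq_lower_lt h0 h_low hz z0 x0.
  rewrite -[X in X < _]nsqJ hJ hE lt_neqAle => /andP[/eqP[]].
  have /(congr1 (fun w : C => Re w)) := E; have /(congr1 (fun w : C => Im w)) := E.
  rewrite /nsq !cE /=; move: cd0; rewrite negb_and.
  set u := (cpoly q).[x]; set v := (cpoly r).[x] => cd0 H1 H2.
  (* Up to sign, a quarter of the difference of the two squared moduli. *)
  suff : Re v * Im u - Im v * Re u = 0 by lra.
  case/orP: cd0 => cd0; apply: (mulfI cd0); rewrite mulr0.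
    transitivity (Re v * (c * Im u) - Im v * (c * Re u)); first by ring.
    have -> : c * Im u = - (d * Im v) by lra.
    have -> : c * Re u = - (d * Re v) by lra.
    ring.
  transitivity ((d * Re v) * Im u - (d * Im v) * Re u); first by ring.
  have -> : d * Re v = - (c * Re u) by lra.
  have -> : d * Im v = - (c * Im u) by lra.
  ring.
have h_real z : root h z -> Im z = 0.
  move=> hz; apply/eqP; rewrite eq_le h_low //= leNgt; apply/negP => z0.
  by apply: hreal; exists z.
have [s sE] := closed_field_poly_normal h.
set e := lead_coef h in sE; pose p := \prod_(z <- s) ('X - (Re z)%:P).
have sroot z : z \in s -> root h z.
  by move=> zs; rewrite sE rootZ ?lead_coef_eq0 // root_prod_XsubC.
have pE : cpoly p = \prod_(z <- s) ('X - z%:P).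
  rewrite /p rmorph_prod /= big_seq [RHS]big_seq; apply: eq_bigr => z zs.
  rewrite rmorphB /= cpolyX cpolyC /=; congr (_ - _%:P).
  by apply/complex_eq => //=; rewrite (h_real _ (sroot _ zs)).
have coefE k : r`_k = Re e * p`_k /\ q`_k = Im e * p`_k.
  have : h`_k = e * (p`_k)%:C by rewrite sE -pE coefZ coef_cpoly.
  rewrite /h coefD coefZ !coef_cpoly => /eqP; rewrite eq_complex !cE /=.
  by rewrite !(mulr0, mul0r, mul1r, subr0, add0r, addr0) => /andP[/eqP-> /eqP->].
have -> : f = (c * Im e + d * Re e) *: p.
  by apply/polyP => k; rewrite coefD !coefZ !(proj1 (coefE k), proj2 (coefE k)); ring.
have [->|k0] := eqVneq (c * Im e + d * Re e) 0; first by left; rewrite scale0r.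
right=> x x0; rewrite cpolyZ hornerZ mulf_neq0 //.
  by rewrite (inj_eq (@complexI R)).
rewrite pE; apply: contra x0; rewrite -/(root _ _) root_prod_XsubC => /sroot/h_real->.
by rewrite eqxx.
Qed.

(** Outside [a, b] the monic polynomials [q] and [r] of equal degree have the same sign, so
    coefficients that do not differ in sign allow no cancellation. *)
Lemma nonneg_combination_rooted_in m a b q r (c d : R) :
  (size q <= m.+1)%N -> (size r <= m.+1)%N ->
  q`_m = 1 -> r`_m = 1 -> rooted_in m a b q -> rooted_in m a b r ->
  (forall x, 0 < Im x -> (cpoly r + 'i *: cpoly q).[x] != 0) ->
  0 <= c * d -> ~ (c = 0 /\ d = 0) -> rooted_in m a b (c *: q + d *: r).
Proof.
move=> sq sr q1 r1 hq hr stab cd0 cdN0.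
have nz (u v : R) : 0 < u -> 0 < v -> c * u + d * v != 0.
  move=> u0 v0; apply/eqP => E; apply: cdN0.
  have E1 : c ^+ 2 * u + c * d * v = 0.
    by transitivity (c * (c * u + d * v)); [ring|rewrite E mulr0].
  have E2 : c * d * u + d ^+ 2 * v = 0.
    by transitivity (d * (c * u + d * v)); [ring|rewrite E mulr0].
  have := sqr_ge0 c; have := sqr_ge0 d => dd cc.
  have p1 := mulr_ge0 cc (ltW u0); have p2 := mulr_ge0 dd (ltW v0).
  have p3 := mulr_ge0 cd0 (ltW u0); have p4 := mulr_ge0 cd0 (ltW v0).
  split; apply/eqP; rewrite -sqrf_eq0.
    by rewrite -(mulIr_eq0 _ (mulIf (lt0r_neq0 u0))); apply/eqP; simpl in *; lra.
  by rewrite -(mulIr_eq0 _ (mulIf (lt0r_neq0 v0))); apply/eqP; simpl in *; lra.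
have fm : (c *: q + d *: r)`_m != 0 by rewrite coefD !coefZ q1 r1 nz ?ltr01.
split=> // x fx; have [f0|freal] := pencil_real_rooted c d stab.
  by rewrite f0 coef0 eqxx in fm.
have x0 := real_rooted_Im0 freal fx.
have xE : x = (Re x)%:C by exact: complex_eq.
exists (Re x) => //; move: fx; rewrite xE horner_cpoly => /complexI.
move: (Re x) => t /eqP ft {x x0 xE}.
have [s [ss sab]] := rooted_in_factor sq hq; rewrite q1 scale1r => qE.
have [s' [ss' sab']] := rooted_in_factor sr hr; rewrite r1 scale1r => rE.
have [qb qa] := horner_prod_bounds t sab; have [rb ra] := horner_prod_bounds t sab'.
rewrite -qE -rE ss ss' in qa qb ra rb.
rewrite !leNgt; apply/andP; split; apply: contraL ft => ht.
  have p0 : 0 < (a - t) ^+ m by rewrite exprn_gt0 ?subr_gt0.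
  have := nz _ _ (lt_le_trans p0 (qa ht)) (lt_le_trans p0 (ra ht)).
  rewrite hornerD !hornerZ; apply: contra => /eqP E.
  apply/eqP; transitivity ((-1) ^+ m * (c * q.[t] + d * r.[t])); first by ring.
  by rewrite E mulr0.
have p0 : 0 < (t - b) ^+ m by rewrite exprn_gt0 ?subr_gt0.
have /andP[q0 _] := qb ht; have /andP[r0 _] := rb ht.
by rewrite hornerD !hornerZ nz // (lt_le_trans p0).
Qed.
End RealRooted.

(** * The symbol of a preserver *)

Section Dichotomy.
Variable R : rcfType.
Notation C := R[i].
Implicit Types (x y z u v : C) (p q : {poly C}) (Q : CP1 R).

Definition segment u v : {poly C} := u%:P + (v - u) *: 'X.

Lemma horner_segment0 u v : (segment u v).[0] = u.
Proof. by rewrite hornerD hornerC hornerZ hornerX mulr0 addr0. Qed.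

Lemma horner_segment1 u v : (segment u v).[1] = v.
Proof. by rewrite hornerD hornerC hornerZ hornerX mulr1 addrC subrK. Qed.

Lemma Im_segment u v (t : R) :
  Im (segment u v).[t%:C] = (1 - t) * Im u + t * Im v.
Proof. by rewrite hornerD hornerC hornerZ hornerX !cE /=; ring. Qed.

Lemma segmentJ u v (t : R) :
  (segment (conjc u) (conjc v)).[t%:C] = conjc ((segment u v).[t%:C]).
Proof.
by apply/complex_eq; rewrite !hornerD !hornerC !hornerZ !hornerX !cE /=; ring.
Qed.

Lemma segment_upper u v (t : R) : 0 < Im u -> 0 < Im v -> 0 <= t <= 1 ->
  0 < Im (segment u v).[t%:C].
Proof. by rewrite Im_segment => u0 v0 /andP[t0 t1]; nra. Qed.

Lemma segment_lower u v (t : R) : Im u < 0 -> Im v < 0 -> 0 <= t <= 1 ->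
  Im (segment u v).[t%:C] < 0.
Proof. by rewrite Im_segment => u0 v0 /andP[t0 t1]; nra. Qed.

Lemma conjpD p q : conjp (p + q) = conjp p + conjp q.
Proof. exact: rmorphD. Qed.

Lemma conjpZ u p : conjp (u *: p) = conjc u *: conjp p.
Proof. by apply/polyP => k; rewrite coefZ !coef_map /= coefZ rmorphM. Qed.

(** Turns an equality of moduli into a linear relation; [w] is a square root of v/u. *)
Lemma exists_unit_rotation u v : nsq u = nsq v ->
  exists2 w, nsq w = 1 & w * u = conjc w * v.
Proof.
move=> uv; have [u0|u0] := eqVneq u 0.
  exists 1; rewrite ?nsq1 // u0 mulr0; apply/esym/eqP.
  by rewrite mulf_eq0 -[v == 0]nsq_eq0 -uv u0 nsq_eq0 eqxx orbT.
pose w := sqrtc (v / u); have w2 : w ^+ 2 = v / u by rewrite sqr_sqrtc.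
have nw : nsq w = 1.
  apply/eqP; rewrite -(@eqrXn2 _ 2) ?nsq_ge0 ?ler01 // expr1n expr2 -nsqM -expr2 w2.
  by rewrite nsqM nsqV uv divff // -uv nsq_eq0.
exists w => //; have ww : conjc w * w = 1.
  apply/complex_eq; rewrite !cE /=; move: nw; rewrite /nsq; last by move=> _; ring.
  by move=> <-; ring.
by rewrite -[v](divfK u0) -w2 expr2 !mulrA ww mul1r.
Qed.

Lemma sub_conjp_nonzero (P : {poly C}) x : (1 < size P)%N ->
  (forall r, root P r -> Im r < 0) -> 0 < Im x -> (P - conjp P).[x] != 0.
Proof.
move=> sP hP x0; have := nsq_lower_lt_size sP hP x0; rewrite -nsq_conjp.
by apply: contraTneq => /eqP; rewrite hornerD hornerN subr_eq0 => /eqP->; rewrite ltxx.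
Qed.

(** The form in the chart at infinity: y^m p(1/y). *)
Definition revp m p := \poly_(j < m.+1) p`_(m - j).

Lemma revp_is_linear m : linear (revp m).
Proof.
move=> c p q; apply/polyP => k; rewrite coefD coefZ !coef_poly.
by case: ifP => _; rewrite ?coefD ?coefZ // mulr0 addr0.
Qed.
HB.instance Definition _ m :=
  GRing.isLinear.Build C {poly C} {poly C} _ (revp m) (revp_is_linear m).

Lemma horner_revp m p y : (size p <= m.+1)%N -> y != 0 ->
  (revp m p).[y] = y ^+ m * p.[y^-1].
Proof.
move=> sp y0; rewrite horner_poly (horner_coef_wide _ sp) mulr_sumr.
rewrite (reindex_inj rev_ord_inj) /=; apply: eq_bigr => j _; rewrite subSS.
rewrite subKn ?leq_ord // mulrCA; congr (_ * _).
by rewrite exprVn expfB_cond // (negPf y0) leq_ord.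
Qed.

(* Every point of the closed half-plane is approached from the open one along a
   polynomial curve; at infinity the curve is followed in the chart [1 : y]. *)
Lemma approach m (s : R) Q : s != 0 -> closed_half s Q ->
  exists e : {linear {poly C} -> {poly C}},
    (forall p, (e p).[0] = pev m p Q) /\
    forall t : R, 0 < t -> exists2 x, 0 < s * Im x &
      forall p, (size p <= m.+1)%N -> (e p).[t%:C] = 0 -> p.[x] = 0.
Proof.
move=> s0; case: Q => [x0|] /= sx.
  (* Along x0 + i s t the quantity s Im grows by s^2 t, whatever the sign of [s]. *)
  exists (comp_poly (x0%:P + (s *i) *: 'X)); split=> [p|t t0].
    by rewrite horner_comp !hornerE.
  exists (x0 + s *i * t%:C).
    have -> : Im (x0 + s *i * t%:C) = Im x0 + s * t by rewrite !cE /=; ring.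
    rewrite mulrDr ltr_wpDl // mulrA mulr_gt0 //.
    by rewrite -expr2 exprn_even_gt0.
  by move=> p _; rewrite horner_comp !hornerE.
(* Inversion reverses the sign of the imaginary part, hence y = - i s t. *)
exists (comp_poly ((- s) *i *: 'X) \o revp m); split=> [p|t t0].
  by rewrite /= horner_comp !hornerE horner_coef0 coef_poly subn0.
have y0 : (- s) *i * t%:C != 0.
  by rewrite mulf_neq0 // eq_complex /= ?eqxx ?andbT ?andTb ?oppr_eq0 // gt_eqF.
exists ((- s) *i * t%:C)^-1.
  rewrite Im_invc mulrA divr_gt0 ?nsq_gt0 //.
  have -> : Im ((- s) *i * t%:C) = - (s * t) by rewrite !cE /=; ring.
  rewrite opprK mulrA mulr_gt0 //.
  by rewrite -expr2 exprn_even_gt0.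
move=> p sp; rewrite /= horner_comp !hornerE horner_revp // => /eqP.
by rewrite mulf_eq0 expf_eq0 (negPf y0) andbF => /eqP.
Qed.

Section Operator.
Variables (n m : nat) (T : {linear {poly C} -> {poly C}}).
Hypothesis size_T : forall p, (size (T p) <= m.+1)%N.
Hypothesis conj_T : forall p, T (conjp p) = conjp (T p).

Definition Tpow z := T (('X - z%:P) ^+ n).

Lemma Tpow_sum z : Tpow z = \sum_(i < n.+1) ((- z) ^+ i *: T 'X^(n - i)) *+ 'C(n, i).
Proof.
rewrite /Tpow -polyCN exprDn linear_sum; apply: eq_bigr => i _.
by rewrite linearMn -rmorphXn mulrC mul_polyC linearZ.
Qed.

Lemma Tpow_conj z : Tpow (conjc z) = conjp (Tpow z).
Proof.
rewrite /Tpow -conj_T; congr (T _).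
by rewrite /conjp rmorphXn rmorphB /= map_polyX map_polyC.
Qed.

Lemma horner_TpowJ z x : (Tpow (conjc z)).[x] = conjc ((Tpow z).[conjc x]).
Proof. by rewrite Tpow_conj horner_conjp. Qed.

Definition curve (U V : {poly C}) : {poly C} :=
  \sum_(i < n.+1) ((- U) ^+ i * (T 'X^(n - i) \Po V)) *+ 'C(n, i).

Lemma horner_curve U V t : (curve U V).[t] = (Tpow U.[t]).[V.[t]].
Proof.
rewrite /curve Tpow_sum !horner_sum; apply: eq_bigr => i _.
by rewrite !hornerMn hornerM horner_exp hornerN horner_comp hornerZ.
Qed.

(** The comparison at (-i, i) is carried along segments, which stay in the two half-planes. If the
    conjugate side is the larger one, its value is the conjugate of F_z(conj x), whence s = -1. *)
Lemma symbol_half_plane :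
  (forall z x, Im z < 0 -> 0 < Im x ->
     nsq (Tpow z).[x] != nsq (Tpow (conjc z)).[x]) ->
  exists2 s : R, s = 1 \/ s = -1 &
    forall z x, Im z < 0 -> 0 < s * Im x -> (Tpow z).[x] != 0.
Proof.
move=> ne.
have zi : Im (- 'i : C) < 0 by rewrite /= oppr_lt0 ltr01.
have xi : 0 < Im ('i : C) by rewrite /= ltr01.
have := ne _ _ zi xi; rewrite neq_lt => /orP[] base.
  exists (-1); first by right.
  move=> z x z0; rewrite mulN1r oppr_gt0 => x0.
  have x0' : 0 < Im (conjc x) by rewrite Im_conjc oppr_gt0.
  have := @nsq_ivt R (curve (segment (conjc (- 'i)) (conjc z)) (segment 'i (conjc x)))
    (curve (segment (- 'i) z) (segment 'i (conjc x))).
  rewrite !horner_curve !horner_segment0 !horner_segment1 => H.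
  have {}H := H _ base; rewrite -[x]conjcK -conjc_eq0 -horner_TpowJ -nsq_gt0.
  apply: le_lt_trans (H _) => [|t t01]; first exact: nsq_ge0.
  by rewrite !horner_curve segmentJ eq_sym ne ?segment_lower ?segment_upper.
exists 1; first by left.
move=> z x z0; rewrite mul1r => x0.
have := @nsq_ivt R (curve (segment (- 'i) z) (segment 'i x))
  (curve (segment (conjc (- 'i)) (conjc z)) (segment 'i x)).
rewrite !horner_curve !horner_segment0 !horner_segment1 => H.
have {}H := H _ base; rewrite -nsq_gt0.
apply: le_lt_trans (H _) => [|t t01]; first exact: nsq_ge0.
by rewrite !horner_curve segmentJ ne ?segment_lower ?segment_upper.
Qed.

Variable A : R -> Prop.
Variable J : R -> Prop.
Let JP Q := exists2 x, J x & Q = Some x%:C.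

(** Hurwitz in the variable [z], with [Q] a limit of points of the open half-plane. The limit is not
    the zero polynomial in [z], as it is nonzero at the point [t0] of [A]. *)
Lemma symbol_boundary (s t0 : R) : s != 0 -> A t0 ->
  (forall z x, Im z < 0 -> 0 < s * Im x -> (Tpow z).[x] != 0) ->
  (forall t Q, A t -> ~ JP Q -> pev m (Tpow t%:C) Q != 0) ->
  forall z Q, lowerU A z -> closed_half s Q -> ~ JP Q -> pev m (Tpow z) Q != 0.
Proof.
move=> s0 At0 hlow hA z Q Kz sQ JQ.
have [z0|[z0 Az]] := Kz; last first.
  by have -> : z = (Re z)%:C by [exact: complex_eq]; apply: hA.
have [e [e0 et]] := approach m s0 sQ.
pose c i := ((-1) ^+ i *: e (T 'X^(n - i))) *+ 'C(n, i).
have cE' w t : (\poly_(i < n.+1) (c i).[t]).[w] = (e (Tpow w)).[t].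
  rewrite horner_poly Tpow_sum linear_sum horner_sum; apply: eq_bigr => i _.
  rewrite linearMn linearZ !hornerMn !hornerZ mulrnAl; congr (_ *+ _).
  by rewrite [in RHS]exprNn mulrAC.
have [] := @hurwitz_half R (-1) n.+1 c.
- by rewrite oppr_eq0 oner_eq0.
- move=> t /andP[t1 _] w; rewrite mulN1r oppr_gt0 => w0; rewrite cE'.
  have [x sx hx] := et t t1; apply: contraNneq (hlow w x w0 sx) => E.
  by apply/eqP/(hx (Tpow w)) => //; exact: size_T.
- move=> /(congr1 (fun p => p.[t0%:C])); rewrite cE' e0 horner0 => /eqP.
  by rewrite (negPf (hA _ _ At0 JQ)).
- by move=> /(_ z); rewrite cE' e0 mulN1r oppr_gt0; apply.
Qed.

Lemma symbol_degenerate z x : (0 < n)%N ->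
  (forall f : {poly R}, (size f <= n.+1)%N -> real_rooted f ->
     T (cpoly f) = 0 \/ (forall x, 0 < Im x -> (T (cpoly f)).[x] != 0)) ->
  Im z < 0 -> 0 < Im x -> nsq (Tpow z).[x] = nsq (Tpow (conjc z)).[x] ->
  forall f : {poly R}, (size f <= n.+1)%N ->
     T (cpoly f) = 0 \/ (forall x, 0 < Im x -> (T (cpoly f)).[x] != 0).
Proof.
move=> n0 hT z0 x0 /exists_unit_rotation[v nv vE] f sf.
have v0 : v != 0 by rewrite -nsq_eq0 nv oner_eq0.
pose P0 := v *: ('X - z%:P) ^+ n.
have main (P : {poly C}) : size P = n.+1 -> (forall r, root P r -> Im r < 0) ->
    T ('i *: (P - conjp P)) = 0 \/
    (forall x, 0 < Im x -> (T ('i *: (P - conjp P))).[x] != 0).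
  move=> sP hP; set K := 'i *: _.
  have KE : K = cpoly (map_poly Re K).
    apply: conjp_eqE; apply/polyP => k; rewrite coef_map !(coefZ, coefB) !coef_map /=.
    by apply/complex_eq; rewrite !cE /=; ring.
  rewrite KE; apply: hT.
    by rewrite (leq_trans (size_poly _ _)) // (leq_trans (size_scale_leq _ _)) //
      (leq_trans (size_polyD _ _)) // size_polyN geq_max sP leqnn (leq_trans (size_poly _ _)) ?sP.
  apply: real_rooted_upper => w w0; rewrite -KE /K hornerZ mulf_neq0 ?complexi_neq0 //.
  by apply: sub_conjp_nonzero; rewrite ?sP.
have T0 : T ('i *: (P0 - conjp P0)) = 0.
  have [||//|/(_ x x0)/eqP[]] := main P0.
  - by rewrite size_scale // size_exp_XsubC.
  - move=> r; rewrite rootZ // /root horner_exp hornerXsubC expf_eq0 n0 subr_eq0.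
    by move=> /eqP->.
  have TP0 : T P0 = v *: Tpow z by rewrite linearZ.
  rewrite linearZ linearB /= conj_T TP0 hornerZ hornerD hornerN horner_conjp !hornerZ.
  by rewrite rmorphM /= -horner_TpowJ vE subrr mulr0.
have [|e e0 he] := @perturb_lower R z (cpoly f) n z0.
  by rewrite size_cpoly.
(* This [c] makes P equal to P0 - i e f, and the difference with the conjugate then contributes the
   real term 2 e f. As [v] is a unit, |c| = e. *)
pose c := - 'i * e%:C / v; pose P := v *: (('X - z%:P) ^+ n + c *: cpoly f).
have vc : v * c = - 'i * e%:C by rewrite /c mulrC divfK.
have PE : 'i *: (P - conjp P) = 'i *: (P0 - conjp P0) + (2 * e)%:C *: cpoly f.
  have {1 2}-> : P = P0 + (- 'i * e%:C) *: cpoly f by rewrite /P scalerDr scalerA vc.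
  rewrite conjpD (conjpZ (- 'i * e%:C)) conjp_cpoly.
  rewrite opprD addrACA scalerDr -scalerBl scalerA; congr (_ + _ *: _).
  by apply/complex_eq; rewrite !cE /=; ring.
have ce : `|c| <= e%:C.
  rewrite normc_def lecR -/(nsq c) /c !nsqM nsqV nv invr1 mulr1.
  have -> : nsq (- 'i) * nsq e%:C = e ^+ 2 by rewrite /nsq /=; ring.
  by rewrite sqrtr_sqr ger0_norm // ltW.
have e2 : (2 * e)%:C != 0 :> C.
  by rewrite (inj_eq (@complexI R)) gt_eqF // mulr_gt0.
have [||Pr|Pr] := main P.
- by rewrite size_scale // (he c ce).1.
- by move=> r; rewrite rootZ //; apply: (he c ce).2.
- left; apply/eqP; move: Pr; rewrite PE linearD T0 add0r linearZ /= => /eqP.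
  by rewrite scaler_eq0 (negPf e2).
- right=> w w0; have := Pr w w0; rewrite PE linearD T0 add0r linearZ /= hornerZ.
  by rewrite mulf_eq0 negb_or => /andP[].
Qed.
End Operator.
End Dichotomy.

(** * Linear spaces of real-rooted polynomials *)

Section Pencil.
Variable R : rcfType.
Notation C := R[i].
Implicit Types (u v x : C) (q r f g : {poly R}).

Lemma real_dependent u v : Re u * Im v - Im u * Re v = 0 ->
  exists c d : R, ~~ ((c == 0) && (d == 0)) /\ c%:C * u + d%:C * v = 0.
Proof.
move=> uv; have [->|u0] := eqVneq u 0.
  by exists 1, 0; rewrite oner_eq0; split=> //; rewrite mulr0 mul0r addr0.
(* Here v conj(u) is real, and the relation is (u conj(u)) v = (v conj(u)) u. *)
exists (- (Re u * Re v + Im u * Im v)), (nsq u).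
rewrite nsq_eq0 (negPf u0) andbF; split=> //.
apply/complex_eq; rewrite /nsq !cE /=.
  transitivity (Im u * - (Re u * Im v - Im u * Re v)); first by ring.
  by rewrite uv oppr0 mulr0.
transitivity (Re u * (Re u * Im v - Im u * Re v)); first by ring.
by rewrite uv mulr0.
Qed.

(** A converse of Hermite-Biehler. Equal moduli at x in the upper half-plane mean that q(x) and r(x)
    are dependent over the reals, so that a nontrivial combination vanishes at x. Hence the moduli
    never agree, and the one larger at i stays larger, so nonzero. *)
Lemma obreschkoff q r :
  (forall c d : R, c *: q + d *: r = 0 \/ real_rooted (c *: q + d *: r)) ->
  (forall c d : R, c *: q + d *: r = 0 -> c = 0 /\ d = 0) ->
  (forall x, 0 < Im x -> (cpoly r + 'i *: cpoly q).[x] != 0) \/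
  (forall x, 0 < Im x -> (cpoly q + 'i *: cpoly r).[x] != 0).
Proof.
move=> rr indep.
have ne x : 0 < Im x ->
    nsq (cpoly r + 'i *: cpoly q).[x] != nsq (cpoly q + 'i *: cpoly r).[x].
  move=> x0; rewrite !hornerD !hornerZ; set u := (cpoly q).[x]; set v := (cpoly r).[x].
  apply/eqP; rewrite /nsq !cE /= => E.
  have [|c [d [cd0 cd]]] := @real_dependent u v; first by lra.
  have := rr c d; case=> [/indep[c0 d0]|/(_ x)]; first by rewrite c0 d0 !eqxx in cd0.
  by rewrite rmorphD /= !cpolyZ hornerD !hornerZ cd eqxx gt_eqF // => /(_ isT).
have i0 : 0 < Im ('i : C) by rewrite ltr01.
have := ne _ i0; rewrite neq_lt => /orP[] base; [right|left] => x x0.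
  have := @nsq_ivt R ((cpoly q + 'i *: cpoly r) \Po segment 'i x)
    ((cpoly r + 'i *: cpoly q) \Po segment 'i x).
  rewrite !horner_comp !horner_segment0 !horner_segment1 => H.
  rewrite -nsq_gt0; apply: le_lt_trans (H _ base); first exact: nsq_ge0.
  by move=> t t01; rewrite !horner_comp eq_sym ne // segment_upper.
have := @nsq_ivt R ((cpoly r + 'i *: cpoly q) \Po segment 'i x)
  ((cpoly q + 'i *: cpoly r) \Po segment 'i x).
rewrite !horner_comp !horner_segment0 !horner_segment1 => H.
rewrite -nsq_gt0; apply: le_lt_trans (H _ base); first exact: nsq_ge0.
by move=> t t01; rewrite !horner_comp ne // segment_upper.
Qed.

(** Evaluation at i is injective on a space of real-rooted polynomials and 0, and C is a real plane.
    The coefficients come from Cramer's rule. *)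
Lemma real_rooted_plane q r g :
  (forall c d e : R, c *: q + d *: r + e *: g = 0 \/
     real_rooted (c *: q + d *: r + e *: g)) ->
  (forall c d : R, c *: q + d *: r = 0 -> c = 0 /\ d = 0) ->
  exists c d : R, g = c *: q + d *: r.
Proof.
move=> rr indep; have i1 : Im ('i : C) != 0 by rewrite oner_eq0.
pose u := (cpoly q).['i]; pose v := (cpoly r).['i]; pose w := (cpoly g).['i].
pose D := Re u * Im v - Im u * Re v.
have D0 : D != 0.
  apply/eqP => /real_dependent[c [d [cd0 cd]]].
  have := rr c d 0; rewrite scale0r addr0; case=> [/indep[c0 d0]|/(_ _ i1)].
    by rewrite c0 d0 !eqxx in cd0.
  by rewrite rmorphD /= !cpolyZ hornerD !hornerZ cd eqxx.
exists ((Re w * Im v - Im w * Re v) / D), ((Re u * Im w - Im u * Re w) / D).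
set c := _ / D; set d := _ / D; apply/eqP; rewrite -subr_eq0.
have := rr (- c) (- d) 1; rewrite scale1r addrC !scaleNr -opprD; case=> [->//|/(_ _ i1)].
rewrite rmorphB rmorphD /= !cpolyZ hornerD hornerN hornerD !hornerZ -/u -/v -/w.
have -> : w = c%:C * u + d%:C * v; last by rewrite subrr eqxx.
by apply/complex_eq; rewrite !cE /= /c /d; move: D0; rewrite /D => D0; field.
Qed.

End Pencil.

Lemma size_prod_XsubC_le (K : nzRingType) n (s : seq K) : size s = n ->
  (size (\prod_(t <- s) ('X - t%:P))%R <= n.+1)%N.
Proof. by move=> <-; rewrite size_prod_XsubC. Qed.

Lemma poly_eq0_interval (R : realFieldType) (p : {poly R}) (c d : R) : c < d ->
  (forall x, c <= x <= d -> p.[x] = 0) -> p = 0.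
Proof.
move=> cd hp; apply/eqP/negPn/negP => p0.
pose N := size p; pose pt (i : nat) := c + (d - c) * (i%:R / N%:R).
have N0 : (0 < N%:R :> R) by rewrite ltr0n size_poly_gt0.
have := @max_poly_roots _ p [seq pt i | i <- iota 0 N] p0.
rewrite size_map size_iota ltnn => H; have : false; last by [].
apply: H.
  apply/allP => x /mapP[j]; rewrite mem_iota add0n => /andP[_ jN] ->.
  have fr : 0 <= (j%:R / N%:R : R) <= 1.
    by rewrite divr_ge0 ?ler0n //= ler_pdivrMr // mul1r ler_nat ltnW.
  by apply/rootP/hp; rewrite /pt; case/andP: fr => ? ?; nra.
rewrite map_inj_uniq ?iota_uniq // => i j /addrI/mulfI.
rewrite subr_eq0 gt_eqF // => /(_ isT)/mulIf; rewrite invr_eq0 gt_eqF // => /(_ isT) /eqP.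
by rewrite eqr_nat => /eqP.
Qed.

(** * Affine inequalities at the ends of a bounded set of reals *)

Section AffineConstraint.
Variable R : realType.
Implicit Types K : set R.

Lemma affine_sup K (c d : R) : K !=set0 -> (exists M, forall s, K s -> s <= M) ->
  (forall s, K s -> s * c <= d) -> sup K * c <= d.
Proof.
move=> K0 [M hM] hK; have Kub : has_ubound K by exists M => s /hM.
have [s Ks] := K0; have [c0|c0|c0] := ltrgt0P c.
- rewrite -ler_pdivlMr //; apply: ge_sup => // t /hK.
  by rewrite -ler_pdivlMr.
- apply: le_trans (hK s Ks); rewrite ler_nM2r //.
  exact: ub_le_sup.
- by have := hK s Ks; rewrite c0 !mulr0.
Qed.

Lemma affine_inf K (c d : R) : K !=set0 -> (exists M, forall s, K s -> M <= s) ->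
  (forall s, K s -> s * c <= d) -> inf K * c <= d.
Proof.
move=> K0 [M hM] hK; have Klb : has_lbound K by exists M => s /hM.
have [s Ks] := K0; have [c0|c0|c0] := ltrgt0P c.
- by apply: le_trans (hK s Ks); rewrite ler_pM2r // ge_inf.
- rewrite -ler_ndivrMr //; apply: lb_le_inf => // t /hK.
  by rewrite -ler_ndivrMr.
- by have := hK s Ks; rewrite c0 !mulr0.
Qed.
End AffineConstraint.

(** * Operators with real-rooted range *)

Section RankTwo.
Variable R : realType.
Implicit Types (f g q r : {poly R}).

Variables (n m : nat) (S : {linear {poly R} -> {poly R}}) (a b : R).
Hypothesis size_S : forall f, (size (S f) <= m.+1)%N.

(** A member of the pencil is determined by its top coefficient and its value at one suitable point,
    so all coordinates needed have this form. *)
Definition affine_functional (c d x : R) f := c * (S f)`_m + d * (S f).[x].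

Lemma affine_functional_is_scalar c d x : scalar (affine_functional c d x).
Proof.
by move=> e f g; rewrite /affine_functional linearP hornerD hornerZ coefD coefZ; ring.
Qed.
HB.instance Definition _ c d x :=
  GRing.isLinear.Build R {poly R} R _ (affine_functional c d x)
    (affine_functional_is_scalar c d x).

Hypothesis real_rooted_S : forall f, (size f <= n.+1)%N ->
  S f = 0 \/ real_rooted (S f).

Variable A : R -> Prop.
Variables lo hi : R.
Hypothesis lo_hi : lo < hi.
Hypothesis A_itv : forall t, lo <= t <= hi -> A t.
Hypothesis rooted_S : forall s : seq R, size s = n -> (forall t, t \in s -> A t) ->
  rooted_in m a b (S (\prod_(t <- s) ('X - t%:P))).

Definition real_decomposition := exists q r (psi1 psi2 : {scalar {poly R}}),
  [/\ forall f, (size f <= n.+1)%N -> S f = psi1 f *: q + psi2 f *: r,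
      [/\ (size q <= m.+1)%N, (size r <= m.+1)%N, q`_m = 1 & r`_m = 1],
      rooted_in m a b q /\ rooted_in m a b r,
      forall x, 0 < Im x -> (cpoly r + 'i *: cpoly q).[x] != 0 &
      forall s : seq R, size s = n -> (forall t, t \in s -> A t) ->
        let p := \prod_(t <- s) ('X - t%:P) in
        0 <= psi1 p * psi2 p /\ ~ (psi1 p = 0 /\ psi2 p = 0)].

Let p0 : {poly R} := ('X - lo%:P) ^+ n.
Let q0 := ((S p0)`_m)^-1 *: S p0.

Lemma rooted_pow t : lo <= t <= hi -> rooted_in m a b (S (('X - t%:P) ^+ n)).
Proof.
move=> /A_itv At; have := @rooted_S (nseq n t); rewrite size_nseq.
rewrite big_nseq iter_mulr_1; apply=> // u /nseqP[-> _]; exact: At.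
Qed.

Lemma size_pow (t : R) : (size (('X - t%:P) ^+ n)%R <= n.+1)%N.
Proof. by rewrite size_exp_XsubC. Qed.

Lemma rooted_inZ c q : c != 0 -> rooted_in m a b q -> rooted_in m a b (c *: q).
Proof.
move=> c0 [qm hq]; split; first by rewrite coefZ mulf_neq0.
move=> x; rewrite cpolyZ hornerZ => /eqP.
by rewrite mulf_eq0 (inj_eq (@complexI R)) (negPf c0) => /eqP/hq.
Qed.

Let Sp0_rooted : rooted_in m a b (S p0).
Proof. by apply: rooted_pow; rewrite lexx ltW. Qed.

Let lc0 : (S p0)`_m != 0.
Proof. by case: Sp0_rooted. Qed.

Let q0_rooted : rooted_in m a b q0.
Proof. by apply: rooted_inZ => //; rewrite invr_eq0. Qed.

Let q0m : q0`_m = 1.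
Proof. by rewrite coefZ mulVf. Qed.

Let size_q0 : (size q0 <= m.+1)%N.
Proof. exact: leq_trans (size_scale_leq _ _) (size_S _). Qed.

(** Taking [q0] twice is legitimate, since q0 + i q0 = (1 + i) q0 is stable. *)
Lemma rank_one_decomposition :
  (forall f, (size f <= n.+1)%N -> S f = (S f)`_m *: q0) -> real_decomposition.
Proof.
move=> hS; exists q0, q0, (affine_functional 1 0 0), (affine_functional 0 0 0).
split=> //.
- move=> f sf; rewrite /= /affine_functional !mul0r !addr0 mul1r scale0r addr0.
  exact: hS.
- move=> x x0; rewrite -[X in X + _]scale1r -scalerDl hornerZ mulf_neq0 //.
    by rewrite eq_complex /= addr0 oner_eq0.
  by apply: (rooted_in_real q0_rooted); rewrite gt_eqF.
move=> s ss hs p; rewrite /= /affine_functional !mul0r !addr0 mul1r mulr0; split=> //.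
by case=> E _; case: (rooted_S ss hs); rewrite -/p E eqxx.
Qed.

(** The range is spanned by [q0] and some [d] of lower degree, so its monic members are the q0 + s
    d. Being [a, b]-rooted amounts to affine inequalities in s, which hold on a compact interval
    [K]; its ends give [q] and [r]. The functionals [psi1] and [psi2] are coordinates in the basis
    q, r, and they have equal signs exactly between the ends. *)
Lemma rank_two_decomposition f1 : (size f1 <= n.+1)%N ->
  S f1 != (S f1)`_m *: q0 -> real_decomposition.
Proof.
have [g0 sg0 Sg0] : exists2 g0 : {poly R}, (size g0 <= n.+1)%N & S g0 = q0.
  exists (((S p0)`_m)^-1 *: p0); last by rewrite linearZ.
  by rewrite (leq_trans (size_scale_leq _ _)) // size_pow.
clearbody q0; move=> sf1 nf1.
have [d dE] : exists d, d = S f1 - (S f1)`_m *: q0 by eexists.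
have d0 : d != 0 by rewrite dE subr_eq0.
have dm : d`_m = 0 by rewrite dE coefB coefZ q0m mulr1 subrr.
have [g1 sg1 Sg1] : exists2 g1 : {poly R}, (size g1 <= n.+1)%N & S g1 = d.
  exists (f1 - (S f1)`_m *: g0); last by rewrite linearB linearZ /= Sg0 dE.
  rewrite (leq_trans (size_polyD _ _)) // geq_max sf1 size_polyN.
  by rewrite (leq_trans (size_scale_leq _ _)).
have rr c e (f : {poly R}) w : (size f <= n.+1)%N ->
    c *: q0 + e *: d + w *: S f = 0 \/ real_rooted (c *: q0 + e *: d + w *: S f).
  move=> sf; have -> : c *: q0 + e *: d + w *: S f = S (c *: g0 + e *: g1 + w *: f).
    by rewrite !linearD !linearZ /= Sg0 Sg1.
  apply: real_rooted_S; rewrite !(leq_trans (size_polyD _ _)) // !geq_max.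
  by rewrite !(leq_trans (size_polyD _ _)) ?geq_max ?(leq_trans (size_scale_leq _ _)).
have rr2 c e : c *: q0 + e *: d = 0 \/ real_rooted (c *: q0 + e *: d).
  by have := rr c e 0 0; rewrite size_poly0 scale0r addr0; apply.
have indep c e : c *: q0 + e *: d = 0 -> c = 0 /\ e = 0.
  move=> E; have c0 : c = 0.
    have /(congr1 (fun p : {poly R} => p`_m)) := E.
    by rewrite coefD !coefZ q0m dm mulr1 mulr0 addr0 coef0.
  move: E; rewrite c0 scale0r add0r => /eqP; rewrite scaler_eq0 (negPf d0) orbF.
  by move/eqP.
(* At this point [sigma] reads off the coordinate along [d]; beyond [b] the bounds on monic members
   are two-sided, which makes [K] bounded. *)
have [x bx dx] : exists2 x, b < x & d.[x] != 0.
  have [//|no] := EM (exists2 x, b < x & d.[x] != 0).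
  suff : d = 0 by move/eqP; rewrite (negPf d0).
  apply: (@poly_eq0_interval _ d (b + 1) (b + 2)); first by lra.
  move=> x /andP[x1 _]; apply/eqP/negPn/negP => dx; apply: no; exists x => //; lra.
pose sigma f := ((S f).[x] - (S f)`_m * q0.[x]) / d.[x].
have S_sigma f : (size f <= n.+1)%N -> S f = (S f)`_m *: q0 + sigma f *: d.
  move=> sf; have [|c [e E]] := @real_rooted_plane R q0 d (S f) _ indep.
    by move=> c e w; apply: rr.
  have cE : (S f)`_m = c by rewrite E coefD !coefZ q0m dm mulr1 mulr0 addr0.
  have -> : sigma f = e.
    by rewrite /sigma cE E hornerD !hornerZ addrAC subrr add0r mulfK.
  by rewrite cE.
(* The bounds of [horner_prod_bounds]. Conversely they force positivity, up to the sign (-1)^m,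
   outside [a, b], which suffices because members of the pencil are real-rooted. *)
pose K : set R := [set s | forall y,
  (b < y -> (y - b) ^+ m <= q0.[y] + s * d.[y] <= (y - a) ^+ m) /\
  (y < a -> (a - y) ^+ m <= (-1) ^+ m * (q0.[y] + s * d.[y]))].
have qsm s : (q0 + s *: d)`_m = 1 by rewrite coefD coefZ q0m dm mulr0 addr0.
have sqs s : (size (q0 + s *: d)%R <= m.+1)%N.
  rewrite (leq_trans (size_polyD _ _)) // geq_max size_q0 (leq_trans (size_scale_leq _ _)) //.
  by rewrite -Sg1 size_S.
have K_rooted s : rooted_in m a b (q0 + s *: d) -> K s.
  move=> hq y; have [u [su uab qE]] := rooted_in_factor (sqs s) hq.
  rewrite qsm scale1r in qE; have := horner_prod_bounds y uab.
  by rewrite /= -qE su hornerD hornerZ.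
have rooted_K s : K s -> rooted_in m a b (q0 + s *: d).
  move=> Ks; split; first by rewrite qsm oner_eq0.
  have [q_0|qr] := rr2 1 s.
    by have := qsm s; rewrite -[q0]scale1r q_0 coef0 => /eqP; rewrite eq_sym oner_eq0.
  rewrite scale1r in qr; move=> y qy; have y0 := real_rooted_Im0 qr qy.
  have yE : y = (Re y)%:C by exact: complex_eq.
  exists (Re y) => //; move: qy; rewrite yE horner_cpoly hornerD hornerZ => /complexI.
  have [Kb Ka] := Ks (Re y).
  move: (Re y) Kb Ka => z Kb Ka E; rewrite /= !leNgt; apply/andP; split; apply/negP => zz.
    have := Ka zz; rewrite E mulr0; apply/negP; rewrite -ltNge.
    by rewrite exprn_gt0 ?subr_gt0.
  have /andP[+ _] := Kb zz; rewrite E; apply/negP; rewrite -ltNge.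
  by rewrite exprn_gt0 ?subr_gt0.
have K0 : K 0 by apply: K_rooted; rewrite scale0r addr0.
have Kne : K !=set0 by exists 0.
have K_bound : exists2 M, forall s, K s -> s <= M & forall s, K s -> - M <= s.
  pose M := (`|q0.[x]| + (x - a) ^+ m) / `|d.[x]|.
  have KM s : K s -> `|s| <= M.
    move=> Ks; have [/(_ bx)/andP[K1 K2] _] := Ks x.
    rewrite ler_pdivlMr ?normr_gt0 // -normrM ler_norml.
    have p1 : 0 <= (x - b) ^+ m by rewrite exprn_ge0 // subr_ge0 ltW.
    have := ler_norm q0.[x]; have := ler_norm (- q0.[x]); rewrite normrN.
    by move=> ? ?; apply/andP; split; lra.
  by exists M => s /KM; rewrite ler_norml => /andP[].
have [M K_le K_ge] := K_bound.
(* Closedness of [K]: it is itself cut out by inequalities affine in s, so whatever satisfies all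
   those valid on [K] belongs to it. *)
have K_affine s : (forall c e, (forall t, K t -> t * c <= e) -> s * c <= e) -> K s.
  move=> hs y; split=> hy.
    have H1 : s * d.[y] <= (y - a) ^+ m - q0.[y].
      apply: hs => t Kt; have [/(_ hy)/andP[_]] := Kt y; lra.
    have H2 : s * - d.[y] <= q0.[y] - (y - b) ^+ m.
      apply: hs => t Kt; have [/(_ hy)/andP[+ _]] := Kt y; lra.
    by apply/andP; split; lra.
  have H : s * - ((-1) ^+ m * d.[y]) <= (-1) ^+ m * q0.[y] - (a - y) ^+ m.
    apply: hs => t Kt; have [_ /(_ hy)] := Kt y; lra.
  lra.
pose s1 := inf K; pose s2 := sup K.
have Ks1 : K s1.
  by apply: K_affine => c e; apply: affine_inf => //; exists (- M).
have Ks2 : K s2.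
  by apply: K_affine => c e; apply: affine_sup => //; exists M.
have K_itv s : K s -> s1 <= s <= s2.
  move=> Ks; rewrite ge_inf ?ub_le_sup //; first by exists M => t /K_le.
  by exists (- M) => t /K_ge.
have sigma_K f : (size f <= n.+1)%N -> rooted_in m a b (S f) ->
    K (sigma f / (S f)`_m).
  move=> sf hf; have fm : (S f)`_m != 0 by case: hf.
  apply: K_rooted; have -> : q0 + (sigma f / (S f)`_m) *: d = ((S f)`_m)^-1 *: S f.
    by rewrite [X in _ = _ *: X]S_sigma // scalerDr !scalerA mulVf // scale1r [_^-1 * _]mulrC.
  by apply: rooted_inZ; rewrite ?invr_eq0.
(* Otherwise [K] is the point 0 and [sigma] vanishes on (X - t)^n for all t in [lo, hi]. These
   powers span the polynomials of degree at most n, yet sigma f1 = 1. *)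
have s12 : s1 < s2.
  rewrite lt_neqAle; have /andP[s10 s02] := K_itv 0 K0.
  rewrite (le_trans s10 s02) andbT; apply/eqP => s12.
  have K_0 s : K s -> s = 0.
    by move=> /K_itv; rewrite -s12 in s02 *; move=> /andP[? ?]; lra.
  have sigma0 t : lo <= t <= hi -> sigma (('X - t%:P) ^+ n) = 0.
    move=> tI; have ht := rooted_pow tI.
    have /K_0/eqP := sigma_K _ (size_pow t) ht.
    by rewrite mulf_eq0 invr_eq0; case: ht => /negPf-> _; rewrite orbF => /eqP.
  pose sigmaf : {scalar {poly R}} :=
    affine_functional (- (q0.[x] / d.[x])) (d.[x])^-1 x.
  have sigmaE f : sigma f = sigmaf f.
    by rewrite /sigma /= /affine_functional; field.
  clearbody sigmaf; pose P := \poly_(j < n.+1) (((-1) ^+ j * sigmaf 'X^(n - j)) *+ 'C(n, j)).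
  have PE t : P.[t] = sigma (('X - t%:P) ^+ n).
    rewrite sigmaE -polyCN exprDn linear_sum horner_poly; apply: eq_bigr => j _.
    have -> : 'X^(n - j) * (- t)%:P ^+ j = (- t) ^+ j *: 'X^(n - j).
      by rewrite -rmorphXn mulrC mul_polyC.
    by rewrite linearMn linearZ /= [(- t) ^+ j]exprNn mulrnAl mulrAC.
  have P0 : P = 0.
    by apply: (poly_eq0_interval lo_hi) => t tI; rewrite PE sigma0.
  have sigmaX k : (k <= n)%N -> sigmaf 'X^k = 0.
    move=> kn; have /eqP : P`_(n - k) = 0 by rewrite P0 coef0.
    rewrite coef_poly ltnS leq_subr subKn // mulrn_eq0 mulf_eq0 expf_eq0.
    rewrite oppr_eq0 oner_eq0 andbF /= -leqn0 leqNgt bin_gt0 leq_subr /=.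
    by move/eqP.
  have : sigma f1 = 0.
    rewrite sigmaE [f1](_ : f1 = \poly_(j < n.+1) f1`_j); last first.
      apply/polyP => k; rewrite coef_poly; case: ltnP => // nk.
      by rewrite nth_default // (leq_trans sf1).
    rewrite poly_def linear_sum big1 // => j _.
    by rewrite linearZ /= sigmaX ?mulr0 // leq_ord.
  have : sigma f1 = 1.
    rewrite /sigma; have -> : (S f1).[x] - (S f1)`_m * q0.[x] = d.[x].
      by rewrite dE hornerD hornerN hornerZ.
    by rewrite divff.
  by move=> -> /eqP; rewrite oner_eq0.
have s21 : s2 - s1 != 0 by rewrite subr_eq0 gt_eqF.
pose psi1 : {scalar {poly R}} := affine_functional
  ((s2 + q0.[x] / d.[x]) / (s2 - s1)) (- (d.[x] * (s2 - s1))^-1) x.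
pose psi2 : {scalar {poly R}} := affine_functional
  (- (s1 + q0.[x] / d.[x]) / (s2 - s1)) ((d.[x] * (s2 - s1))^-1) x.
have psi1E f : psi1 f = (s2 * (S f)`_m - sigma f) / (s2 - s1).
  by rewrite /= /affine_functional /sigma; field; rewrite s21 dx.
have psi2E f : psi2 f = (sigma f - s1 * (S f)`_m) / (s2 - s1).
  by rewrite /= /affine_functional /sigma; field; rewrite s21 dx.
pose q := q0 + s1 *: d; pose r := q0 + s2 *: d.
have SE f : (size f <= n.+1)%N -> S f = psi1 f *: q + psi2 f *: r.
  move=> sf; rewrite psi1E psi2E [LHS]S_sigma //.
  rewrite /q /r !scalerDr !scalerA addrACA -!scalerDl; congr (_ *: _ + _ *: _); field.
    exact: s21.
  exact: s21.
have pos (s : seq R) : size s = n -> (forall t, t \in s -> A t) ->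
  let p := \prod_(t <- s) ('X - t%:P) in
  0 <= psi1 p * psi2 p /\ ~ (psi1 p = 0 /\ psi2 p = 0).
  move=> ss hs p; have sp := size_prod_XsubC_le ss.
  have hp := rooted_S ss hs; have pm : (S p)`_m != 0 by case: hp.
  have /K_itv/andP[] := sigma_K _ sp hp.
  rewrite psi1E psi2E -/p; set t := sigma p / _ => st1 st2.
  have -> : sigma p = t * (S p)`_m by rewrite divfK.
  have s12_gt0 : 0 < s2 - s1 by rewrite subr_gt0.
  split.
    have -> : (s2 * (S p)`_m - t * (S p)`_m) / (s2 - s1) *
        ((t * (S p)`_m - s1 * (S p)`_m) / (s2 - s1)) =
        ((S p)`_m / (s2 - s1)) ^+ 2 * ((s2 - t) * (t - s1)) by field.
    by rewrite mulr_ge0 ?sqr_ge0 // mulr_ge0 ?subr_ge0.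
  case=> E1 E2; have : (S p)`_m = 0; last by move/eqP; rewrite (negPf pm).
  transitivity ((s2 * (S p)`_m - t * (S p)`_m) / (s2 - s1) +
      (t * (S p)`_m - s1 * (S p)`_m) / (s2 - s1)); first by field.
  by rewrite E1 E2 addr0.
(* Which end interlaces the other is not known beforehand; the rest of the conclusion allows
   exchanging them together with their functionals. *)
have [] := @obreschkoff R q r.
- move=> c e; rewrite /q /r !scalerDr !scalerA addrACA -!scalerDl; exact: rr2.
- move=> c e; rewrite /q /r !scalerDr !scalerA addrACA -!scalerDl.
  move=> /indep[ce E]; have e0 : e * (s2 - s1) = 0.
    by have cE : c = - e by [lra]; rewrite cE in E; lra.
  have {}e0 : e = 0 by move/eqP: e0; rewrite mulf_eq0 (negPf s21) orbF => /eqP.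
  by split=> //; lra.
- move=> stab; exists q, r, psi1, psi2; split=> //.
    by split; [exact: sqs|exact: sqs|exact: qsm|exact: qsm].
  by split; exact: rooted_K.
move=> stab; exists r, q, psi2, psi1; split=> //.
- by move=> f sf; rewrite SE // addrC.
- by split; [exact: sqs|exact: sqs|exact: qsm|exact: qsm].
- by split; exact: rooted_K.
move=> s ss hs p; have [p1 p2] := pos s ss hs; split; first by rewrite mulrC.
by case=> E1 E2; apply: p2.
Qed.

Theorem real_rooted_decomposition : real_decomposition.
Proof.
have [|no] := EM (forall f, (size f <= n.+1)%N -> S f = (S f)`_m *: q0).
  exact: rank_one_decomposition.
have [f [sf nf]] : exists f, (size f <= n.+1)%N /\ S f != (S f)`_m *: q0.
  apply: contra_notP no => no f sf; apply/eqP/negPn/negP => nf.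
  by apply: no; exists f.
exact: rank_two_decomposition nf.
Qed.
End RankTwo.

(** * Transfer to homogeneous polynomials *)

Section Bridge.
Variable R : realType.
Notation C := R[i].

Lemma meval_coords n (p : V C n) (P : CP1 R) :
  (p : {mpoly C[2]}).@[coords P] = pev n (dehom p) P.
Proof.
rewrite meval_dehom /heval; case: P => [t|]; rewrite /coords /=.
  rewrite (horner_coef_wide _ (size_dehom p)); apply: eq_bigr => k _.
  by rewrite (_ : tnth _ ord_max = 1) // expr1n mulr1.
rewrite big_ord_recr /= (_ : tnth _ ord0 = 1) // (_ : tnth _ ord_max = 0) //.
rewrite expr1n subnn expr0 !mulr1 big1 ?add0r // => k _.
by rewrite expr0n subn_eq0 leqNgt ltn_ord /= !mulr0.
Qed.

Lemma rootedE n (D : set (CP1 R)) (p : V C n) :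
  rooted D p <-> forall P, pev n (dehom p) P = 0 -> D P.
Proof. by split=> hp P; have := hp P; rewrite meval_coords. Qed.

Lemma dehom_eq0 (K : comNzRingType) n (p : V K n) : (dehom p == 0) = (p == 0).
Proof. by rewrite -(inj_eq (can_inj (@dehomK K n))) linear0. Qed.

Lemma dehom_cplx n (p : V R n) : dehom (cplx p) = cpoly (dehom p).
Proof. exact: dehom_map. Qed.

Lemma hom_coef_eq (K : comNzRingType) n (f g : {poly K}) :
  (forall k, (k <= n)%N -> f`_k = g`_k) -> hom n f = hom n g.
Proof. by move=> fg; apply: eq_bigr => k _; rewrite fg // leq_ord. Qed.

Lemma hom_cpoly n (f : {poly R}) : cplx (hom n f) = hom n (cpoly f).
Proof.
rewrite -[LHS]dehomK dehom_cplx; apply: hom_coef_eq => k kn.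
by rewrite !coef_cpoly coef_poly ltnS kn (@mcoeff_hom _ n f (Ordinal (kn : k < n.+1)%N)).
Qed.

Lemma hom_Xn (K : comNzRingType) n (k : 'I_n.+1) : hom n 'X^k = monomial K k.
Proof.
rewrite /hom (bigD1 k) //= coefXn eqxx scale1r big1 ?addr0 // => j jk.
by rewrite coefXn (inj_eq val_inj) (negPf jk) scale0r.
Qed.

Lemma cplxRI n (p : V C n) : p = cplx (polyRe p) + 'i *: cplx (polyIm p).
Proof.
apply/(can_inj (@dehomK C n)); rewrite linearD linearZ /= !dehom_cplx !dehom_map.
apply/polyP => k; rewrite coefD coefZ !coef_cpoly !coef_map_id0 //.
by rewrite -complexE.
Qed.

Lemma polyRe_cplx n (p : V R n) : polyRe (cplx p) = p.
Proof.
apply/(can_inj (@dehomK R n)); rewrite dehom_map dehom_cplx.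
by apply/polyP => k; rewrite coef_map_id0 // coef_cpoly.
Qed.

Lemma polyIm_cplx n (p : V R n) : polyIm (cplx p) = 0.
Proof.
apply/(can_inj (@dehomK R n)); rewrite dehom_map dehom_cplx linear0.
by apply/polyP => k; rewrite coef_map_id0 // coef_cpoly coef0.
Qed.

Lemma cextend_cplx n (psi : {scalar V R n}) (p : V R n) :
  cextend psi (cplx p) = (psi p)%:C.
Proof. by rewrite /cextend polyRe_cplx polyIm_cplx linear0 mulr0 addr0. Qed.

Lemma top_monicE n (p : V R n) : top_monic p <-> (dehom p)`_n = 1.
Proof.
rewrite /top_monic coef_poly ltnSn subnn.
by rewrite (_ : bidegree n 0 = U_(ord0) *+ n)%MM // /bidegree mulm0n addm0.
Qed.

Lemma pevD n (f g : {poly C}) P : pev n (f + g) P = pev n f P + pev n g P.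
Proof. by case: P => [t|]; rewrite /= ?hornerD ?coefD. Qed.

Lemma pev_sum n k (F : 'I_k -> {poly C}) P :
  pev n (\sum_(j < k) F j) P = \sum_(j < k) pev n (F j) P.
Proof.
apply: (big_morph (fun f => pev n f P)) => [f g|]; first exact: pevD.
by case: P => [t|]; rewrite /= ?horner0 ?coef0.
Qed.

Lemma lower_interval (I : interval R) (z : C) :
  (lower_half `|` real_points [set` I]) (Some z) <-> lowerU (fun t => t \in I) z.
Proof.
split=> [[[t t0 [<-]]|[t /= tI [<-]]]|[z0|[z0 zI]]]; [by left|by right|left|right].
  by exists z.
by exists (Re z) => //; congr Some; apply/complex_eq.
Qed.

Lemma lower_interval_finite (I : interval R) P :
  (lower_half `|` real_points [set` I]) P -> exists z, P = Some z.
Proof. by case=> [[t _ <-]|[t _ <-]]; [exists t|exists t%:C]. Qed.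

Lemma closed_upper_halfE (Q : CP1 R) : closed_upper_half Q <-> closed_half 1 Q.
Proof.
rewrite /closed_upper_half /extended_reals; split.
  by case=> [[t /= t0 <-]|[[t _ <-]|->]] //=; rewrite mul1r // ltW.
case: Q => [t|_] /=; last by right; right.
rewrite mul1r le_eqVlt => /orP[/eqP t0|t0]; last by left; exists t.
by right; left; exists (Re t) => //; congr Some; apply/complex_eq.
Qed.

Lemma closed_lower_halfE (Q : CP1 R) : closed_lower_half Q <-> closed_half (-1) Q.
Proof.
rewrite /closed_lower_half /extended_reals; split.
  by case=> [[t /= t0 <-]|[[t _ <-]|->]] //=; rewrite mulN1r oppr_ge0 // ltW.
case: Q => [t|_] /=; last by right; right.
rewrite mulN1r oppr_ge0 le_eqVlt => /orP[/eqP t0|t0]; last by left; exists t.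
by right; left; exists (Re t) => //; congr Some; apply/complex_eq.
Qed.

Lemma interval_convex (I : interval R) (s t w : R) :
  s \in I -> t \in I -> s <= w <= t -> w \in I.
Proof.
case: I => [[bl l|bl] [br r|br]]; rewrite !itv_boundlr /= => /andP[sl sr] /andP[tl tr] /andP[sw wt];
 apply/andP; split=> //.
- by apply: le_trans sl _; rewrite bnd_simp.
- by apply: le_trans _ tr; rewrite bnd_simp.
- by apply: le_trans sl _; rewrite bnd_simp.
- by apply: le_trans _ tr; rewrite bnd_simp.
Qed.

Lemma rooted_real_points n (J : set R) (p : V C n) :
  rooted (real_points J) p -> exists c s,
    [/\ c != 0, size s = n, forall t, t \in s -> J t &
        dehom p = c *: \prod_(t <- s) ('X - t%:C%:P)].
Proof.
move/rootedE => hp; have [s sE] := closed_field_poly_normal (dehom p).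
have pn : (dehom p)`_n != 0.
  by apply/eqP => pn; have := hp None pn; case.
have size_p : size (dehom p) = n.+1.
  apply/eqP; rewrite eqn_leq size_dehom ltnNge; apply/negP => sg'.
  by rewrite nth_default ?eqxx in pn.
have lc0 : lead_coef (dehom p) != 0 by rewrite lead_coefE size_p.
have hs z : z \in s -> exists2 t, J t & z = t%:C.
  move=> zs; have [|t Jt [<-]] := hp (Some z); last by exists t.
  rewrite /= sE hornerZ; suff /rootP-> : root (\prod_(z0 <- s) ('X - z0%:P)) z by rewrite mulr0.
  by rewrite root_prod_XsubC.
exists (lead_coef (dehom p)), [seq Re z | z <- s]; split=> //.
- rewrite size_map; have := size_p; rewrite sE size_scale // size_prod_XsubC.
  by case.
- by move=> t /mapP[z /hs[u Ju ->] ->].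
rewrite big_map {1}sE; congr (_ *: _); rewrite big_seq [RHS]big_seq.
by apply: eq_bigr => z /hs[t _ ->].
Qed.

Lemma prod_rooted n (J : set R) (c : C) (s : seq R) (p : V C n) : c != 0 ->
  size s = n -> (forall t, t \in s -> J t) ->
  dehom p = c *: \prod_(t <- s) ('X - t%:C%:P) -> rooted (real_points J) p.
Proof.
move=> c0 ss hs pE; apply/rootedE => P; rewrite pE pevZ.
have -> : \prod_(t <- s) ('X - t%:C%:P) = \prod_(z <- [seq t%:C | t <- s]) ('X - z%:P) :> {poly C}.
  by rewrite big_map.
move=> /eqP; rewrite mulf_eq0 (negPf c0) /=; case: P => [z|] /=.
  rewrite -/(root _ _) root_prod_XsubC => /mapP[t /hs Jt ->].
  by exists t.
have := monicP (monic_prod_XsubC [seq t%:C | t <- s] xpredT id : _ \is (@monic C)).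
rewrite lead_coefE size_prod_XsubC size_map ss /= => ->.
by rewrite oner_eq0.
Qed.

Lemma extended_realsE (P : CP1 R) :
  extended_reals P <-> (if P is Some t then Im t = 0 else True).
Proof.
split=> [[[t _ <-]|->] //|]; case: P => [t|_]; last by right.
by move=> t0; left; exists (Re t) => //; congr Some; apply/complex_eq.
Qed.

Lemma rooted_extended n (p : V R n) :
  rooted extended_reals (cplx p) <-> real_rooted (dehom p).
Proof.
split=> [/rootedE hp x x0|hp].
  apply/eqP => px; have := hp (Some x); rewrite dehom_cplx => /(_ px)/extended_realsE x0'.
  by rewrite x0' eqxx in x0.
apply/rootedE => -[x|_]; last by apply/extended_realsE.
rewrite dehom_cplx.
by move=> px; apply/extended_realsE; exact: real_rooted_Im0 hp px.
Qed.

End Bridge.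

(** * The operator and its symbol in univariate form *)

Section Univariate.
Variable R : realType.
Notation C := R[i].
Variables (n m : nat) (T : 'Hom(V C n, V C m)).

Definition dehom_op (f : {poly C}) : {poly C} := dehom (T (hom n f)).

Lemma dehom_op_is_linear : linear dehom_op.
Proof. by move=> c f g; rewrite /dehom_op !linearP. Qed.
HB.instance Definition _ :=
  GRing.isLinear.Build C {poly C} {poly C} _ dehom_op dehom_op_is_linear.

Lemma dehom_opE p : dehom (T p) = dehom_op (dehom p).
Proof. by rewrite /dehom_op dehomK. Qed.

Lemma size_dehom_op f : (size (dehom_op f) <= m.+1)%N.
Proof. exact: size_dehom. Qed.

Definition dehom_op_real (f : {poly R}) : {poly R} := map_poly Re (dehom_op (cpoly f)).

Lemma dehom_op_real_is_linear : linear dehom_op_real.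
Proof.
move=> c f g; apply/polyP => k; rewrite coefD coefZ !coef_map_id0 //.
by rewrite rmorphD /= cpolyZ linearP coefD coefZ !cE /= mul0r subr0.
Qed.
HB.instance Definition _ :=
  GRing.isLinear.Build R {poly R} {poly R} _ dehom_op_real dehom_op_real_is_linear.

Hypothesis realT : real_operator T.

Lemma dehom_op_cpoly f : dehom_op (cpoly f) = cpoly (dehom_op_real f).
Proof.
have [q qE] := realT (hom n f); rewrite hom_cpoly in qE.
rewrite /dehom_op_real /dehom_op qE dehom_cplx; congr cpoly.
by apply/polyP => k; rewrite coef_map_id0 // coef_cpoly.
Qed.

Lemma dehom_op_conjp p : dehom_op (conjp p) = conjp (dehom_op p).
Proof.
pose f := map_poly Re p; pose g := map_poly Im p.
have -> : p = cpoly f + 'i *: cpoly g.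
  by apply/polyP => k; rewrite coefD coefZ !coef_cpoly !coef_map_id0 // -complexE.
by rewrite conjpD conjpZ !conjp_cpoly !linearD !linearZ /= !dehom_op_cpoly
   conjpD conjpZ !conjp_cpoly.
Qed.

(** At w = y = 1 the symbol uses (z - x)^n while [Tpow] uses (x - z)^n, whence the sign. *)
Lemma meval_Symb z Q :
  (Symb T).@[coords2 (Some z, Q)] = (-1) ^+ n * pev m (Tpow n dehom_op z) Q.
Proof.
rewrite /Symb raddf_sum Tpow_sum pev_sum mulr_sumr (reindex_inj rev_ord_inj) /=.
apply: eq_bigr => k _; rewrite subSS -scaler_nat !pevZ mevalZ !mevalM.
rewrite !rmorphXn /= rmorphN /= !mevalXU.
have -> : coords2 (Some z, Q) (lshift 2 ord0) = z.
  by rewrite /coords2 (unsplitK (inl _)).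
have -> : coords2 (Some z, Q) (lshift 2 ord_max) = 1.
  by rewrite /coords2 (unsplitK (inl _)).
have -> : (second_pair (T (monomial R[i] (rev_ord k)))).@[coords2 (Some z, Q)] =
    pev m (dehom_op 'X^(n - k)) Q.
  rewrite /second_pair comp_mpoly_meval.
  have -> : 'X^(n - k) = 'X^(rev_ord k) :> {poly C} by rewrite /= subSS.
  rewrite /dehom_op hom_Xn -meval_coords; apply: meval_eq => j.
  by rewrite tnth_mktuple mevalXU /coords2 (unsplitK (inr _)).
rewrite subKn ?leq_ord // bin_sub ?leq_ord //.
rewrite exprNn [in (- z) ^+ k]exprNn.
have <- : (-1) ^+ (n - k) * (-1) ^+ k = (-1) ^+ n :> C by rewrite -exprD subnK // leq_ord.
have : (-1) ^+ k * (-1) ^+ k = 1 :> C by rewrite -expr2 sqrr_sign.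
move: ((-1) ^+ k : C) => e ee; rewrite expr1n mulr1.
transitivity ('C(n, k)%:R * (z ^+ k * (-1) ^+ (n - k) * pev m (dehom_op 'X^(n - k)) Q) * (e * e)).
  by rewrite ee mulr1.
ring.
Qed.

Lemma Symb_neq0 z Q :
  ((Symb T).@[coords2 (Some z, Q)] != 0) = (pev m (Tpow n dehom_op z) Q != 0).
Proof. by rewrite meval_Symb mulf_eq0 signr_eq0. Qed.

End Univariate.

Lemma scale_comb (K : comNzRingType) (M : lmodType K) (i c1 c2 d1 d2 : K) (u v : M) :
  (c1 *: u + c2 *: v) + i *: (d1 *: u + d2 *: v) =
  (c1 + i * d1) *: u + (c2 + i * d2) *: v.
Proof. by rewrite scalerDr !scalerA addrACA !scalerDl. Qed.

Lemma dehom_comb (K : comNzRingType) n (c d : K) (p q : V K n) :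
  dehom (c *: p + d *: q) = c *: dehom p + d *: dehom q.
Proof. by rewrite linearD !linearZ. Qed.

Lemma dehom_addi (R : realType) n (q r : V R n) :
  dehom (cplx r + 'i *: cplx q) = cpoly (dehom r) + 'i *: cpoly (dehom q).
Proof. by rewrite linearD linearZ /= !dehom_cplx. Qed.

Lemma cpoly_comb (R : rcfType) (c d : R) (p q : {poly R}) :
  cpoly (c *: p + d *: q) = c%:C *: cpoly p + d%:C *: cpoly q.
Proof. by rewrite rmorphD /= !cpolyZ. Qed.

(** * The two implications *)

Section Equivalence.
Variable R : realType.
Notation C := R[i].
Variables (n m : nat) (T : 'Hom(V C n, V C m)).
Hypothesis realT : real_operator T.
Variable I : interval R.
Hypothesis properI : exists c d : R, [/\ c \in I, d \in I & c < d].
Variables a b : R.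

Let A t : Prop := t \in I.
Let J x : Prop := a <= x <= b.
Let IP := real_points [set` I].
Let JP := real_points `[a, b].
Let U : {linear {poly C} -> {poly C}} := dehom_op T.

Let JPE Q : JP Q <-> exists2 x, J x & Q = Some x%:C.
Proof.
by split=> [[x Jx <-]|[x Jx ->]]; exists x => //; move: Jx; rewrite /= in_itv.
Qed.

Let JP_None : ~ JP None.
Proof. by case. Qed.

Definition preserves_roots :=
  preserves_weak_real_rootedness T /\
  (forall p : V R[i] n, rooted IP p -> T p != 0 /\ rooted JP (T p)).

Definition real_rank_two := exists (q r : V R m) (psi1 psi2 : {scalar V R n}),
  [/\ forall p : V R[i] n,
        T p = cextend psi1 p *: cplx q + cextend psi2 p *: cplx r,
      [/\ top_monic q, top_monic r,
          weakly_rooted JP (cplx q) & weakly_rooted JP (cplx r)],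
      interlaces q r &
      forall p : V R n, rooted IP (cplx p) ->
        0 <= psi1 p * psi2 p /\ ~ (psi1 p = 0 /\ psi2 p = 0)].

Lemma rooted_in_JP (g : {poly R}) :
  rooted_in m a b g <-> forall Q, pev m (cpoly g) Q = 0 -> JP Q.
Proof.
split=> [[gm hg] [x|]|hg] /=.
- by move=> /hg[t tab ->]; apply/JPE; exists t.
- by rewrite coef_cpoly => /complexI gm0; rewrite gm0 eqxx in gm.
split; first by apply/eqP => gm; case: (hg None); rewrite /= ?coef_cpoly ?gm.
by move=> x gx; have /JPE[t tab [->]] := hg (Some x) gx; exists t.
Qed.

Lemma prod_cpoly (s : seq R) :
  cpoly (\prod_(t <- s) ('X - t%:P)) = \prod_(t <- s) ('X - t%:C%:P) :> {poly C}.
Proof.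
rewrite rmorph_prod; apply: eq_bigr => t _.
by rewrite rmorphB /= cpolyX cpolyC.
Qed.

Lemma real_rooted_extended (f : {poly R}) : f = 0 \/ real_rooted f ->
  forall q : V C m, dehom q = cpoly f -> weakly_rooted extended_reals q.
Proof.
move=> hf q qE; case: hf => [f0|hf].
  by right; apply/eqP; rewrite -dehom_eq0 qE f0 rmorph0.
left; apply/rootedE => -[x|_]; last by apply/extended_realsE.
by rewrite qE => fx; apply/extended_realsE; exact: real_rooted_Im0 hf fx.
Qed.

Lemma stable_preserves_roots (s : R) : s != 0 ->
  (forall z Q, lowerU A z -> closed_half s Q -> ~ JP Q -> pev m (Tpow n U z) Q != 0) ->
  preserves_roots.
Proof.
move=> s0 stab.
have stab' z Q : lowerU A z -> closed_half s Q ->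
    ~ (exists2 x, J x & Q = Some x%:C) -> pev m (U (('X - z%:P) ^+ n)) Q != 0.
  by move=> Kz sQ JQ; apply: stab => // /JPE.
have conjU := dehom_op_conjp realT.
split=> [p /rooted_extended hp|p /rooted_real_points[c [r [c0 sr hr pE]]]].
  have [r rE] := real_rooted_factor hp.
  have sr : (size r <= n)%N.
    have := size_dehom p; rewrite rE size_scale ?lead_coef_eq0 ?real_rooted_neq0 //.
    by rewrite size_prod_XsubC.
  have UE : dehom (T (cplx p)) = (lead_coef (dehom p))%:C *:
      U (\prod_(t <- r) ('X - t%:C%:P)).
    by rewrite dehom_opE dehom_cplx {1}rE cpolyZ prod_cpoly; exact: linearZ.
  have lc0 : (lead_coef (dehom p))%:C != 0 :> C.
    by rewrite (inj_eq (@complexI R)) lead_coef_eq0 real_rooted_neq0.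
  have [U0|U0] := eqVneq (U (\prod_(t <- r) ('X - t%:C%:P))) 0.
    by right; apply/eqP; rewrite -dehom_eq0 UE U0 scaler0.
  left; apply/rootedE => -[x|_]; last by apply/extended_realsE.
  rewrite UE pevZ => /eqP; rewrite mulf_eq0 (negPf lc0) /= => Ux.
  apply/extended_realsE/eqP/negPn/negP => x0.
  have := @stable_real_rooted R n m U (size_dehom_op T) conjU A (@interval_convex R I) J s s0 stab' r x sr x0.
  by case=> [/eqP|]; rewrite ?(negPf U0) // Ux.
have UE : dehom (T p) = c *: U (\prod_(t <- r) ('X - t%:C%:P)).
  by rewrite dehom_opE pE; exact: linearZ.
have ne Q : ~ JP Q -> pev m (dehom (T p)) Q != 0.
  move=> JQ; rewrite UE pevZ mulf_neq0 //.
  apply: (@stable_interval_rooted R n m U conjU A (@interval_convex R I) J s stab') => //.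
  by move/JPE.
split.
  (* Infinity lies outside J, so the nonzero value there already makes T p nonzero. *)
  rewrite -dehom_eq0; apply: contraNneq (ne None JP_None) => ->.
  by rewrite /= coef0.
apply/rootedE => Q /eqP QE; have [//|JQ] := EM (JP Q).
by have := ne Q JQ; rewrite QE.
Qed.

Lemma rank_two_preserves_roots : real_rank_two -> preserves_roots.
Proof.
move=> [q [r [psi1 [psi2 [TE [q1 r1 wq wr] qr pos]]]]].
move/top_monicE in q1; move/top_monicE in r1.
have nz (g : V R m) : (dehom g)`_m = 1 -> cplx g != 0.
  move=> g1; rewrite -dehom_eq0 dehom_cplx; apply/eqP => g0.
  have /(congr1 (fun f : {poly C} => f`_m)) := g0.
  by rewrite coef_cpoly g1 coef0 => /eqP; rewrite oner_eq0.
have rootedW (g : V R m) : (dehom g)`_m = 1 -> weakly_rooted JP (cplx g) ->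
    rooted_in m a b (dehom g).
  move=> g1 [/rootedE hg|g0]; last by have := nz g g1; rewrite g0 eqxx.
  by apply/rooted_in_JP; rewrite -dehom_cplx.
have hq := rootedW q q1 wq; have hr := rootedW r r1 wr.
have stab x : 0 < Im x -> (cpoly (dehom r) + 'i *: cpoly (dehom q)).[x] != 0.
  have hE := dehom_addi q r.
  case: qr => [st x0|E].
    have := st (Some x); rewrite meval_coords hE; apply.
    by exists x.
  have /(congr1 (fun f : {poly C} => f`_m)) := hE.
  rewrite E linear0 coef0 coefD coefZ !coef_cpoly q1 r1 => /eqP.
  by rewrite eq_sym mulr1 eq_complex /= addr0 oner_eq0.
have TcE (p : V R n) : dehom (T (cplx p)) =
    cpoly (psi1 p *: dehom q + psi2 p *: dehom r).
  by rewrite TE !cextend_cplx dehom_comb !dehom_cplx cpoly_comb.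
split=> [p _|p hp].
  apply: real_rooted_extended (TcE p).
  exact: pencil_real_rooted.
have [c [s [c0 ss hs pE]]] := rooted_real_points hp.
(* An I-rooted complex polynomial is a scalar times a real one, to which the sign condition
   applies. *)
pose p0 : V R n := hom n (\prod_(t <- s) ('X - t%:P)).
have p0E : dehom p0 = \prod_(t <- s) ('X - t%:P) by rewrite homK // size_prod_XsubC_le.
have pcE : p = c *: cplx p0.
  apply/(can_inj (@dehomK C n)); rewrite linearZ /= dehom_cplx p0E prod_cpoly.
  exact: pE.
have hp0 : rooted IP (cplx p0).
  apply: (@prod_rooted R n _ 1 s) => //; first exact: oner_neq0.
  by rewrite scale1r dehom_cplx p0E prod_cpoly.
have [pos1 pos2] := pos p0 hp0.
have /rooted_in_JP main : rooted_in m a b (psi1 p0 *: dehom q + psi2 p0 *: dehom r).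
  exact: (nonneg_combination_rooted_in (size_dehom q) (size_dehom r)).
have ne Q : ~ JP Q -> pev m (dehom (T p)) Q != 0.
  move=> JQ; rewrite pcE linearZ /= linearZ /= pevZ mulf_neq0 // TcE.
  by apply/eqP => /main.
split.
  rewrite -dehom_eq0; apply: contraNneq (ne None JP_None) => ->.
  by rewrite /= coef0.
apply/rootedE => Q /eqP QE; have [//|JQ] := EM (JP Q).
by have := ne Q JQ; rewrite QE.
Qed.

Section Converse.
Hypothesis preserveT : preserves_roots.
Let S : {linear {poly R} -> {poly R}} := dehom_op_real T.

Let U_cpoly g : U (cpoly g) = cpoly (S g).
Proof. exact: dehom_op_cpoly. Qed.

Lemma size_dehom_op_real f : (size (S f) <= m.+1)%N.
Proof. exact: leq_trans (size_poly _ _) (size_dehom_op T _). Qed.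

Lemma dehom_op_real_rooted (f : {poly R}) : (size f <= n.+1)%N -> real_rooted f ->
  S f = 0 \/ real_rooted (S f).
Proof.
move=> sf hf; have fE : dehom (hom n f) = f by rewrite homK.
have hp : rooted extended_reals (cplx (hom n f)).
  by apply/rooted_extended; rewrite fE.
have UE : dehom (T (cplx (hom n f))) = cpoly (S f).
  by rewrite dehom_opE dehom_cplx fE dehom_op_cpoly.
have [/rootedE hT|T0] := proj1 preserveT _ hp; [right|left].
  move=> x x0; apply/eqP => Sx; have := hT (Some x); rewrite UE => /(_ Sx)/extended_realsE.
  by move=> x0'; rewrite x0' eqxx in x0.
by apply: (@cpoly_inj R); rewrite rmorph0 -UE T0 linear0.
Qed.

Lemma dehom_op_real_rooted_in (s : seq R) : size s = n -> (forall t, t \in s -> A t) ->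
  rooted_in m a b (S (\prod_(t <- s) ('X - t%:P))).
Proof.
move=> ss hs; set f := \prod_(t <- s) _.
have fE : dehom (hom n f) = f by rewrite homK // size_prod_XsubC_le.
have hp : rooted IP (cplx (hom n f)).
  apply: (@prod_rooted R n _ 1 s) => //; first exact: oner_neq0.
  by rewrite scale1r dehom_cplx fE prod_cpoly.
have UE : dehom (T (cplx (hom n f))) = cpoly (S f).
  by rewrite dehom_opE dehom_cplx fE dehom_op_cpoly.
have [_ /rootedE hT] := proj2 preserveT _ hp.
by apply/rooted_in_JP; rewrite -UE.
Qed.

Lemma real_rooted_rank_two :
  (forall f : {poly R}, (size f <= n.+1)%N -> S f = 0 \/ real_rooted (S f)) ->
  (\dim (limg T) <= 2)%N /\ real_rank_two.
Proof.
move=> rrS; have [lo [hi [loI hiI lohi]]] := properI.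
have [q [r [psi1 [psi2 [SE [sq sr q1 r1] [hq hr] stab pos]]]]] :=
  @real_rooted_decomposition R n m S a b size_dehom_op_real rrS A lo hi lohi
    (fun t => @interval_convex R I lo hi t loI hiI) dehom_op_real_rooted_in.
pose q' : V R m := hom m q; pose r' : V R m := hom m r.
have qE : dehom q' = q by rewrite homK.
have rE : dehom r' = r by rewrite homK.
pose phi1 : {scalar V R n} := psi1 \o @dehom R n.
pose phi2 : {scalar V R n} := psi2 \o @dehom R n.
have TcE (p : V R n) : T (cplx p) = (phi1 p)%:C *: cplx q' + (phi2 p)%:C *: cplx r'.
  apply/(can_inj (@dehomK C m)); rewrite dehom_opE dehom_cplx dehom_op_cpoly //.
  by rewrite dehom_comb !dehom_cplx qE rE -cpoly_comb; congr cpoly; rewrite -SE ?size_dehom.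
have TE (p : V C n) : T p = cextend phi1 p *: cplx q' + cextend phi2 p *: cplx r'.
  rewrite {1}[p]cplxRI linearD linearZ /= !TcE; exact: scale_comb.
have rootedW (g : {poly R}) (g' : V R m) : dehom g' = g -> rooted_in m a b g ->
    weakly_rooted JP (cplx g').
  by move=> gE /rooted_in_JP hg; left; apply/rootedE; rewrite dehom_cplx gE.
split.
  apply: leq_trans (dim_span [:: cplx q'; cplx r']).
  apply/dimvS/subvP => v /memv_imgP[p _ ->]; rewrite TE.
  by rewrite memvD // memvZ // memv_span // !inE eqxx ?orbT.
exists q', r', phi1, phi2; split=> //.
- by split; [apply/top_monicE; rewrite qE|apply/top_monicE; rewrite rE|
    exact: rootedW qE hq|exact: rootedW rE hr].
- left=> P [x x0 <-]; rewrite meval_coords dehom_addi qE rE.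
  exact: stab.
move=> p /rooted_real_points[c [s [c0 ss hs pE]]].
(* The scalar [c] is real because [p] is. *)
have pE' : dehom p = Re c *: \prod_(t <- s) ('X - t%:P).
  apply/polyP => k; rewrite -[LHS]/(Re ((dehom p)`_k)%:C) -coef_cpoly -dehom_cplx pE.
  by rewrite -prod_cpoly !coefZ coef_cpoly Re_mulc /= mulr0 subr0.
have c0' : Re c != 0.
  apply: contra c0 => /eqP rc; have : dehom p = 0 by rewrite pE' rc scale0r.
  move=> p00; rewrite dehom_cplx p00 rmorph0 in pE.
  have /eqP := pE; rewrite eq_sym scaler_eq0 => /orP[//|/eqP].
  by move/eqP; rewrite prodf_seq_eq0 => /hasP[t _]; rewrite polyXsubC_eq0.
have [p1 p2] := pos s ss hs.
rewrite /phi1 /phi2 /= pE' !linearZ /=; split.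
  by rewrite mulrACA mulr_ge0 // -expr2 sqr_ge0.
case=> /eqP E1 /eqP E2; apply: p2; move: E1 E2.
by rewrite !mulf_eq0 (negPf c0') /= => /eqP-> /eqP->.
Qed.

Lemma preserves_roots_cases :
  [\/ forall z Q, lowerU A z -> closed_half 1 Q -> ~ JP Q -> pev m (Tpow n U z) Q != 0,
      forall z Q, lowerU A z -> closed_half (-1) Q -> ~ JP Q -> pev m (Tpow n U z) Q != 0 |
      (\dim (limg T) <= 2)%N /\ real_rank_two].
Proof.
(* For n = 0 there is no root to make Hermite-Biehler strict, but every nonzero constant is
   real-rooted, so all images are real-rooted or 0. *)
have [n0|n0] := posnP n.
  apply: Or33; apply: real_rooted_rank_two => f sf.
  have [->|f0] := eqVneq f 0; first by left; rewrite linear0.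
  apply: dehom_op_real_rooted => // x _; rewrite n0 in sf.
  rewrite (size1_polyC sf) in f0 *; rewrite cpolyC hornerC.
  by rewrite (inj_eq (@complexI R)); rewrite polyC_eq0 in f0.
have [gen|deg] := EM (forall z x, Im z < 0 -> 0 < Im x ->
     nsq (Tpow n U z).[x] != nsq (Tpow n U (conjc z)).[x]).
  have [s s1 hs] := symbol_half_plane (dehom_op_conjp realT) gen.
  have [lo [hi [loI _ _]]] := properI.
  have s0 : s != 0 by case: s1 => ->; rewrite ?oppr_eq0 oner_eq0.
  have hI t Q : A t -> ~ (exists2 x, J x & Q = Some x%:C) ->
      pev m (Tpow n U t%:C) Q != 0.
    move=> At JQ; have := @dehom_op_real_rooted_in (nseq n t).
    rewrite size_nseq big_nseq iter_mulr_1 => hr.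
    have /rooted_in_JP main : rooted_in m a b (S (('X - t%:P) ^+ n)).
      by apply: hr => // u /nseqP[-> _].
    apply/eqP => E; apply: JQ; apply/JPE/main.
    by rewrite -U_cpoly rmorphXn rmorphB /= cpolyX cpolyC.
  have main := @symbol_boundary R n m U (size_dehom_op T) A J s lo s0 loI hs hI.
  have {}main z Q : lowerU A z -> closed_half s Q -> ~ JP Q -> pev m (Tpow n U z) Q != 0.
    by move=> Kz sQ JQ; apply: main => // /JPE.
  by case: s1 main => ->; [apply: Or31|apply: Or32].
apply: Or33; apply: real_rooted_rank_two => f sf.
have [z [x [z0 x0 E]]] : exists z x, [/\ Im z < 0, 0 < Im x &
    nsq (Tpow n U z).[x] = nsq (Tpow n U (conjc z)).[x]].
  apply: contra_notP deg => no z x z0 x0; apply/eqP => E.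
  by apply: no; exists z, x.
have hT (g : {poly R}) : (size g <= n.+1)%N -> real_rooted g ->
    U (cpoly g) = 0 \/ (forall y, 0 < Im y -> (U (cpoly g)).[y] != 0).
  move=> sg hg; rewrite U_cpoly; case: (dehom_op_real_rooted sg hg) => [E0|hS].
    by left; rewrite E0 rmorph0.
  by right=> y y0; apply: hS; rewrite gt_eqF.
have [U0|hU] := symbol_degenerate (dehom_op_conjp realT) n0 hT z0 x0 E sf; [left|right].
  by apply: (@cpoly_inj R); rewrite rmorph0 -U_cpoly.
by apply: real_rooted_upper => y y0; rewrite -U_cpoly hU.
Qed.

End Converse.

Lemma stable2_Symb (s : R) (H : set (CP1 R)) :
  (forall Q, H Q <-> closed_half s Q) ->
  stable2 ((lower_half `|` IP) `*` (H `\` JP)) (Symb T) <->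
  (forall z Q, lowerU A z -> closed_half s Q -> ~ JP Q -> pev m (Tpow n U z) Q != 0).
Proof.
move=> HE; split=> [st z Q /lower_interval Kz /HE HQ JQ|st [P Q] /= [KP [HQ JQ]]].
  by rewrite -Symb_neq0; apply: st.
have [z zE] := lower_interval_finite KP; rewrite zE in KP *.
by rewrite Symb_neq0; apply: st => //; [apply/lower_interval|apply/HE].
Qed.

End Equivalence.

Theorem theorem7p8 (R : realType) (n m : nat) (T : 'Hom(V R[i] n, V R[i] m))
    (realT : real_operator T)
    (I : interval R) (properI : exists c d : R, [/\ c \in I, d \in I & c < d])
    (a b : R) (le_ab : a <= b) :
  let IP := real_points [set` I] in
  let JP := real_points `[a, b] in
  (preserves_weak_real_rootedness T /\
   (forall p : V R[i] n, rooted IP p -> T p != 0 /\ rooted JP (T p)))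
  <->
  [\/ stable2 ((lower_half `|` IP) `*` (closed_upper_half `\` JP)) (Symb T),
      stable2 ((lower_half `|` IP) `*` (closed_lower_half `\` JP)) (Symb T) |
      (\dim (limg T) <= 2)%N /\
      exists (q r : V R m) (psi1 psi2 : {scalar V R n}),
        [/\ forall p : V R[i] n,
              T p = cextend psi1 p *: cplx q + cextend psi2 p *: cplx r,
            [/\ top_monic q, top_monic r,
                weakly_rooted JP (cplx q) & weakly_rooted JP (cplx r)],
            interlaces q r &
            forall p : V R n, rooted IP (cplx p) ->
              0 <= psi1 p * psi2 p /\ ~ (psi1 p = 0 /\ psi2 p = 0)] ].
Proof.
move=> IP JP.
have upE := stable2_Symb T I a b (@closed_upper_halfE R).
have lowE := stable2_Symb T I a b (@closed_lower_halfE R).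
split=> [/(preserves_roots_cases realT properI)[/upE|/lowE|] H|].
- exact: Or31.
- exact: Or32.
- exact: Or33.
case=> [/upE|/lowE|[_]].
- by apply: (stable_preserves_roots realT); rewrite oner_eq0.
- by apply: (stable_preserves_roots realT); rewrite oppr_eq0 oner_eq0.
exact: rank_two_preserves_roots.
Qed.
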